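(* Let $K$ be a complete discretely valued field with ring of integers $\mathcal{O}_K$, uniformiser $\pi$ and residue field $\mathbb{F}$, and let $\rho\colon G\to\mathrm{GL}(V)$ be an irreducible representation of a group $G$ on a finite-dimensional $K$-vector space $V$ admitting at least one $\rho(G)$-stable lattice. Write $\overline\rho^{ss}=\bigoplus_{i=1}^rW_i^{m_i}$ with the $W_i$ pairwise non-isomorphic irreducible $\mathbb{F}[G]$-modules. Then $|\mathcal{X}_{\max}(\rho)|\ge1+\dim\mathcal{X}(\rho)$, with equality if $m_i=1$ for all $i$. In particular, the number of extremal vertices of $\mathcal{X}(\rho)$ is at least $1+\dim\mathcal{X}(\rho)$.
   Context: A lattice is a free $\mathcal{O}_K$-submodule of $V$ of rank $\dim_KV$; $\mathcal{X}(V)$ is the set of homothety classes of lattices, made into a simplicial complex (the Bruhat–Tits building of $\mathrm{PGL}(V)$) in which $x_0,\dots,x_n$ span an $n$-dimensional face if they have representatives with $\pi\Lambda_{x_0}\subsetneq\Lambda_{x_1}\subsetneq\cdots\subsetneq\Lambda_{x_n}\subsetneq\Lambda_{x_0}$. $\mathcal{X}(\rho)$ is the subcomplex spanned by classes of $\rho(G)$-stable lattices, and $\dim\mathcal{X}(\rho)$ its dimension. In the geometric realisation of $\mathcal{X}(V)$ any two points are joined by a unique geodesic $[yz]$; a point $x\in\mathcal{X}(\rho)$ is extremal if $x\in[yz]$ with $y,z\in\mathcal{X}(\rho)$ implies $x=y$ or $x=z$. $\overline\rho^{ss}$ is the semisimplification of $\Lambda/\pi\Lambda$ for any stable $\Lambda$.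 A stable lattice $\Lambda$ is normalised at a nonzero $v\in V$ if $v\in\Lambda$ and its image in $\Lambda/\pi\Lambda$ is nonzero; it is maximal with respect to $v$ if maximal under inclusion among stable lattices normalised at $v$; maximal if maximal with respect to some nonzero $v$. $\mathcal{X}_{\max}(\rho)$ is the set of classes of maximal stable lattices. *)

(* Defs.v *)
From HB Require Import structures.
From mathcomp Require Import all_boot all_order all_algebra.
From mathcomp Require Import all_classical all_reals.

Set Implicit Arguments.
Unset Strict Implicit.
Unset Printing Implicit Defensive.

Import Order.TTheory GRing.Theory Num.Theory.

Local Open Scope classical_set_scope.
Local Open Scope ring_scope.

(* The value of [v] at 0 is irrelevant: [val_ge v N x] reads "v(x) >= N", with
   the convention that v(0) is infinite. *)
Definition val_ge (K : fieldType) (v : K -> int) (N : int) (x : K) : Prop :=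
  x = 0 \/ N <= v x.

(* The valuation is normalised: [v] maps the nonzero elements onto Z. *)
Definition discrete_valuation (K : fieldType) (v : K -> int) : Prop :=
  [/\ forall x y, x != 0 -> y != 0 -> v (x * y) = v x + v y,
      forall x y, x != 0 -> y != 0 -> x + y != 0 ->
        Num.min (v x) (v y) <= v (x + y)
    & exists2 x, x != 0 & v x = 1].

Definition val_complete (K : fieldType) (v : K -> int) : Prop :=
  forall u : nat -> K,
    (forall N : int, exists n0 : nat, forall m n : nat,
       (n0 <= m)%N -> (n0 <= n)%N -> val_ge v N (u m - u n)) ->
    exists l : K, forall N : int, exists n0 : nat, forall n : nat,
       (n0 <= n)%N -> val_ge v N (u n - l).

Definition integers (K : fieldType) (v : K -> int) : set K :=
  [set x | val_ge v 0 x].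

Definition uniformiser (K : fieldType) (v : K -> int) (pi : K) : Prop :=
  pi != 0 /\ v pi = 1.

(* [red], restricted to the ring of integers, is a surjective ring morphism onto
   [F] whose kernel is the maximal ideal; it exhibits [F] as the residue field.
   Its values outside the ring of integers are irrelevant. *)
Definition residue_map (K : fieldType) (v : K -> int) (F : fieldType)
    (red : K -> F) : Prop :=
  [/\ red 1 = 1,
      forall x y, integers v x -> integers v y ->
        red (x + y) = red x + red y /\ red (x * y) = red x * red y,
      forall a : F, exists2 x, integers v x & red x = a
    & forall x, integers v x -> (red x = 0 <-> val_ge v 1 x)].

Definition representation (k : fieldType) (G : groupType) (V : vectType k)
    (rho : G -> 'End(V)) : Prop :=
  rho 1%g = \1%VF /\ forall g h, rho (g * h)%g = (rho g \o rho h)%VF.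

Definition stable_subspace (k : fieldType) (G : groupType) (V : vectType k)
    (rho : G -> 'End(V)) (U : {vspace V}) : Prop :=
  forall g, (rho g @: U <= U)%VS.

Definition irreducible (k : fieldType) (G : groupType) (V : vectType k)
    (rho : G -> 'End(V)) : Prop :=
  {:V}%VS <> 0%VS /\
  forall U : {vspace V}, stable_subspace rho U -> U = 0%VS \/ U = {:V}%VS.

Definition isomorphic (k : fieldType) (G : groupType) (V W : vectType k)
    (rho : G -> 'End(V)) (sigma : G -> 'End(W)) : Prop :=
  exists f : 'Hom(V, W),
    [/\ lker f = 0%VS, limg f = {:W}%VS
      & forall g x, f (rho g x) = sigma g (f x)].

(* U2/U1 is isomorphic to [sigma]: instead of forming the quotient, we ask for
   an equivariant surjection of U2 onto W with kernel U1. *)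
Definition subquotient_isomorphic (k : fieldType) (G : groupType)
    (V W : vectType k) (rho : G -> 'End(V)) (U1 U2 : {vspace V})
    (sigma : G -> 'End(W)) : Prop :=
  exists f : 'Hom(V, W),
    [/\ (f @: U2)%VS = {:W}%VS, (U2 :&: lker f)%VS = U1
      & forall g x, x \in U2 -> f (rho g x) = sigma g (f x)].

(* The semisimplification of [tau], i.e. the direct sum of the factors of a
   composition series 0 = U_0 < U_1 < ... < U_N, is isomorphic to the direct sum
   of the W_i^(m_i), the W_i being irreducible and pairwise non-isomorphic. *)
Definition semisimplification (k : fieldType) (G : groupType) (E : vectType k)
    (tau : G -> 'End(E)) (r : nat) (W : 'I_r -> vectType k)
    (sigma : forall i, G -> 'End(W i)) (m : 'I_r -> nat) : Prop :=
  [/\ forall i, representation (sigma i),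
      forall i, irreducible (sigma i),
      forall i j, i != j -> ~ isomorphic (sigma i) (sigma j)
    & exists (N : nat) (U : nat -> {vspace E}) (kappa : 'I_N -> 'I_r),
        [/\ U 0%N = 0%VS /\ U N = {:E}%VS,
            forall j : 'I_N, (U j <= U j.+1)%VS,
            forall j : nat, (j <= N)%N -> stable_subspace tau (U j),
            forall j : 'I_N, subquotient_isomorphic tau (U j) (U j.+1)
                               (sigma (kappa j))
          & forall i, #|[pred j | kappa j == i]| = m i]].

Definition integral_span (K : fieldType) (v : K -> int) (V : vectType K)
    (n : nat) (e : 'I_n -> V) : set V :=
  [set x | exists2 c : 'I_n -> K,
     forall i, integers v (c i) & x = \sum_i c i *: e i].

(* Linear independence over the ring of integers and over K are the same. *)
Definition lattice (K : fieldType) (v : K -> int) (V : vectType K)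
    (L : set V) : Prop :=
  exists2 b : (\dim {:V}).-tuple V,
    free b & L = integral_span v (fun i => tnth b i).

Definition dilate (K : fieldType) (V : vectType K) (c : K) (L : set V) : set V :=
  [set c *: x | x in L].

Definition homothety_class (K : fieldType) (V : vectType K) (L : set V) :
    set (set V) :=
  [set dilate c L | c in [set c : K | c != 0]].

Definition stable_lattice (K : fieldType) (v : K -> int) (G : groupType)
    (V : vectType K) (rho : G -> 'End(V)) (L : set V) : Prop :=
  lattice v L /\ forall g x, L x -> L (rho g x).

(* [phi] induces an isomorphism of representations over the residue field from
   L / pi L onto [tau]. *)
Definition reduction (K : fieldType) (v : K -> int) (pi : K) (F : fieldType)
    (red : K -> F) (G : groupType) (V : vectType K) (rho : G -> 'End(V))
    (L : set V) (E : vectType F) (tau : G -> 'End(E)) (phi : V -> E) : Prop :=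
  [/\ forall x y, L x -> L y -> phi (x + y) = phi x + phi y,
      forall c x, integers v c -> L x -> phi (c *: x) = red c *: phi x,
      forall y : E, exists2 x, L x & phi x = y,
      forall x, L x -> (phi x = 0 <-> dilate pi L x)
    & forall g x, L x -> phi (rho g x) = tau g (phi x)].

Definition residual_semisimplification (K : fieldType) (v : K -> int) (pi : K)
    (F : fieldType) (red : K -> F) (G : groupType) (V : vectType K)
    (rho : G -> 'End(V)) (r : nat) (W : 'I_r -> vectType F)
    (sigma : forall i, G -> 'End(W i)) (m : 'I_r -> nat) : Prop :=
  exists (L : set V) (E : vectType F) (tau : G -> 'End(E)) (phi : V -> E),
    [/\ stable_lattice v rho L, representation tau,
        reduction v pi red rho L tau phi & semisimplification tau sigma m].

Definition normalised_at (K : fieldType) (pi : K) (V : vectType K)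
    (L : set V) (x : V) : Prop :=
  L x /\ ~ dilate pi L x.

Definition maximal_at (K : fieldType) (v : K -> int) (pi : K) (G : groupType)
    (V : vectType K) (rho : G -> 'End(V)) (L : set V) (x : V) : Prop :=
  [/\ stable_lattice v rho L, normalised_at pi L x
    & forall L', stable_lattice v rho L' -> normalised_at pi L' x ->
        L `<=` L' -> L' = L].

Definition maximal_lattice (K : fieldType) (v : K -> int) (pi : K)
    (G : groupType) (V : vectType K) (rho : G -> 'End(V)) (L : set V) : Prop :=
  exists2 x : V, x != 0 & maximal_at v pi rho L x.

Definition X_max (K : fieldType) (v : K -> int) (pi : K)
    (G : groupType) (V : vectType K) (rho : G -> 'End(V)) : set (set (set V)) :=
  [set homothety_class L | L in [set L | maximal_lattice v pi rho L]].

Definition face (K : fieldType) (v : K -> int) (pi : K) (V : vectType K)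
    (n : nat) (x : 'I_n.+1 -> set (set V)) : Prop :=
  exists L : 'I_n.+1 -> set V,
    [/\ forall i, lattice v (L i) /\ x i = homothety_class (L i),
        forall i : 'I_n.+1, (0 < i)%N ->
          dilate pi (L ord0) `<` L i /\ L i `<` L ord0
      & forall i j : 'I_n.+1, (0 < i)%N -> (i < j)%N -> L i `<` L j].

Definition X_vertices (K : fieldType) (v : K -> int)
    (G : groupType) (V : vectType K) (rho : G -> 'End(V)) : set (set (set V)) :=
  [set homothety_class L | L in [set L | stable_lattice v rho L]].

Definition X_has_face (K : fieldType) (v : K -> int) (pi : K)
    (G : groupType) (V : vectType K) (rho : G -> 'End(V)) (n : nat) : Prop :=
  exists2 x : 'I_n.+1 -> set (set V),
    face v pi x & forall i, X_vertices v rho (x i).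

(* A maximum exists as soon as there is a stable lattice, since every face has
   dimension less than dim V. *)
Definition X_dim (K : fieldType) (v : K -> int) (pi : K)
    (G : groupType) (V : vectType K) (rho : G -> 'End(V)) : nat :=
  get [set d : nat | X_has_face v pi rho d /\
                     forall n, X_has_face v pi rho n -> (n <= d)%N].

(* Points of the geometric realisation are families of barycentric coordinates
   on the vertices, supported on a face. *)
Definition barycentric (R : realType) (K : fieldType) (v : K -> int) (pi : K)
    (V : vectType K) (n : nat) (x : 'I_n.+1 -> set (set V))
    (p : set (set V) -> R) : Prop :=
  [/\ face v pi x, forall i, 0 <= p (x i), \sum_i p (x i) = 1
    & forall y, ~ range x y -> p y = 0].

Definition realisation (R : realType) (K : fieldType) (v : K -> int) (pi : K)
    (V : vectType K) : set (set (set V) -> R) :=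
  [set p | exists n (x : 'I_n.+1 -> set (set V)), barycentric v pi x p].

Definition X_realisation (R : realType) (K : fieldType) (v : K -> int) (pi : K)
    (G : groupType) (V : vectType K) (rho : G -> 'End(V)) :
    set (set (set V) -> R) :=
  [set p | realisation v pi p /\ forall y, p y != 0 -> X_vertices v rho y].

Definition vertex_point (R : realType) (K : fieldType) (V : vectType K)
    (x : set (set V)) : set (set V) -> R :=
  fun y => if `[< y = x >] then 1 else 0.

Definition apartment_lattice (K : fieldType) (v : K -> int) (pi : K)
    (V : vectType K) (b : (\dim {:V}).-tuple V) (a : 'I_(\dim {:V}) -> int) :
    set V :=
  integral_span v (fun i => pi ^ (a i) *: tnth b i).

(* The point [p] lies in the apartment of the basis [b], where it has affine
   coordinates [c]. As the exponents [a j] of a vertex are unique up to a common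
   integer, [c] is unique up to a common real number: it is a point of
   R^n / R(1,...,1). *)
Definition apartment_coordinates (R : realType) (K : fieldType) (v : K -> int)
    (pi : K) (V : vectType K) (b : (\dim {:V}).-tuple V)
    (p : set (set V) -> R) (c : 'I_(\dim {:V}) -> R) : Prop :=
  exists n (x : 'I_n.+1 -> set (set V)) (a : 'I_n.+1 -> 'I_(\dim {:V}) -> int),
    [/\ barycentric v pi x p,
        forall j, x j = homothety_class (apartment_lattice v pi b (a j))
      & forall i, c i = \sum_j p (x j) * (a j i)%:~R].

(* The Euclidean distance on R^n / R(1,...,1), identified with the orthogonal
   complement of (1,...,1). *)
Definition euclidean_dist (R : realType) (n : nat) (c c' : 'I_n -> R) : R :=
  let mean := (\sum_i (c i - c' i)) / n%:R in
  Num.sqrt (\sum_i (c i - c' i - mean) ^+ 2).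

(* The metric of the building, as a relation: any two points lie in a common
   apartment, and their distance does not depend on its choice. *)
Definition building_dist (R : realType) (K : fieldType) (v : K -> int)
    (pi : K) (V : vectType K) (p q : set (set V) -> R) (d : R) : Prop :=
  exists (b : (\dim {:V}).-tuple V) (c c' : 'I_(\dim {:V}) -> R),
    [/\ basis_of {:V} b, apartment_coordinates v pi b p c,
        apartment_coordinates v pi b q c' & d = euclidean_dist c c'].

(* [y z]: the points on an isometrically embedded interval joining y to z. *)
Definition geodesic (R : realType) (K : fieldType) (v : K -> int)
    (pi : K) (V : vectType K) (y z : set (set V) -> R) :
    set (set (set V) -> R) :=
  [set x | exists (l : R) (gamma : R -> set (set V) -> R),
     [/\ 0 <= l, gamma 0 = y, gamma l = z,
         forall s t, 0 <= s <= l -> 0 <= t <= l ->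
           building_dist v pi (gamma s) (gamma t) `|s - t|
       & exists2 t, 0 <= t <= l & x = gamma t]].

Definition extremal (R : realType) (K : fieldType) (v : K -> int)
    (pi : K) (G : groupType) (V : vectType K) (rho : G -> 'End(V))
    (x : set (set V) -> R) : Prop :=
  X_realisation v pi rho x /\
  forall y z, X_realisation v pi rho y -> X_realisation v pi rho z ->
    geodesic v pi y z x -> x = y \/ x = z.

Definition extremal_vertices (R : realType) (K : fieldType) (v : K -> int)
    (pi : K) (G : groupType) (V : vectType K) (rho : G -> 'End(V)) :
    set (set (set V)) :=
  [set x | X_vertices v rho x /\ extremal v pi rho (vertex_point R x)].

(* Main.v *)
Require Import Defs.
From HB Require Import structures.
From mathcomp Require Import all_boot all_order all_fingroup all_algebra.
From mathcomp Require Import all_classical all_reals.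
From mathcomp Require Import zify ring lra.

(** Every stable O-submodule that contains a lattice and no line is a lattice,
    by completeness, so stable lattices containing a given one and avoiding a
    given vector have maximal elements.

    A face of X(rho) is a period of a pi-periodic chain A_0 < ... < A_N = pi^-1 A_0.
    For x_i in A_{i+1} but not in A_i, a stable lattice containing A_i and
    maximal among those avoiding x_i is a maximal lattice; two of these are never
    homothetic, whence the lower bound. A maximal lattice M has a unique minimal
    stable lattice M+ above it, and M+/M is one of the factors A_{j+1}/A_j. If
    the factors are pairwise non-isomorphic, j determines the class of M: scale
    M' so that it lies in M but not in pi M; unless M' = M, the j-th factor would
    occur both in the kernel and in the image of M'/pi M' -> M/pi M.

    For extremality, a point of the building is viewed as a norm on V, the
    barycentre of the gauges of the vertices of its face. If x lies on the
    geodesic from y to z, the majorisation of relative positions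
    lambda(y,z) by lambda(y,x) + lambda(x,z) is an equality, all three vectors
    being proportional, and so the vectors on which y - x is maximal are among
    those on which z - x is minimal. If x is the class of a maximal lattice M,
    every vector of M+ is represented modulo M by vectors on which y - x,
    respectively z - x, is maximal; this is absurd unless y = x or z = x. *)

Set Implicit Arguments.
Unset Strict Implicit.
Unset Printing Implicit Defensive.

Import Order.TTheory GRing.Theory Num.Theory.

Local Open Scope classical_set_scope.
Local Open Scope card_scope.
Local Open Scope ring_scope.


(** Three points of the building need not lie in a common apartment. The three distances along a
    geodesic therefore come with three unrelated bases, and the inequality of relative positions has
    to be proved across changes of basis, by determinants; only its equality case speaks about
    individual vectors.

    An occurrence of a factor in a subquotient P/Q of V is recorded as a [jump]: the step of the
    doubly infinite chain pi^k A_j at which the chain first meets P outside Q. Such a step carries a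
    type j and a scale k. When the factors are pairwise non-isomorphic the type is forced, and a
    second occurrence of it in M'/pi M' is excluded by comparing scales. *)

Lemma int_threshold (P : int -> Prop) :
  (forall i j, i <= j -> P i -> P j) -> (exists i, P i) -> (exists i, ~ P i) ->
  exists i, P i /\ ~ P (i - 1).
Proof.
move=> Pup [i Pi] [j NPj].
have lt_ji : j < i by rewrite ltNge; apply/negP => /Pup /(_ Pi).
have [n ijn] : exists n : nat, i = j + n%:Z.
  by exists (`|i - j|)%N; lia.
subst i; elim: n Pi {lt_ji} => [|n IHn] Pn; first by rewrite addr0 in Pn.
have [Pn'|NPn'] := pselect (P (j + n%:Z)); first exact: IHn.
exists (j + n.+1%:Z); split=> //.
by have -> : j + n.+1%:Z - 1 = j + n%:Z by lia.
Qed.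

(** * Valuations, modules over the ring of integers, and bases over a complete field *)

Section Valuation.
Context (K : fieldType) (v : K -> int) (Hv : discrete_valuation v).
Context (pi : K) (Hpi : uniformiser v pi).

Lemma valuM x y : x != 0 -> y != 0 -> v (x * y) = v x + v y.
Proof. by case: Hv => h _ _; exact: h. Qed.

Lemma valu1 : v 1 = 0.
Proof.
by apply: (@addrI _ (v 1)); rewrite -valuM ?oner_neq0 // mulr1 addr0.
Qed.

Lemma valuN x : v (- x) = v x.
Proof.
have [->|x0] := eqVneq x 0; first by rewrite oppr0.
have N1 : (-1 : K) != 0 by rewrite oppr_eq0 oner_neq0.
have vN1 : v (-1) = 0.
  have : v (-1) + v (-1) = 0 by rewrite -valuM // mulrNN mulr1 valu1.
  lia.
by rewrite -mulN1r valuM // vN1 add0r.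
Qed.

Lemma valuV x : x != 0 -> v x^-1 = - v x.
Proof.
move=> x0; apply: (@addrI _ (v x)).
by rewrite -valuM ?invr_eq0 // mulfV // valu1 subrr.
Qed.

Lemma pi_neq0 : pi != 0.
Proof. by case: Hpi. Qed.

Lemma piX_neq0 (k : int) : pi ^ k != 0.
Proof. by rewrite expfz_neq0 ?pi_neq0. Qed.

Lemma val_piX (k : int) : v (pi ^ k) = k.
Proof.
have vn (n : nat) : v (pi ^+ n) = n%:Z.
  elim: n => [|n IHn]; first by rewrite expr0 valu1.
  rewrite exprS valuM ?expf_neq0 ?pi_neq0 // IHn.
  by case: Hpi => _ ->; lia.
case: k => n; first exact: vn.
rewrite NegzE -exprz_inv -exprnP exprVn valuV ?expf_neq0 ?pi_neq0 //.
by rewrite vn.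
Qed.

Lemma val_unit_part (c : K) : c != 0 -> exists2 a, integers v a /\ integers v a^-1 & c = a * pi ^ (v c).
Proof.
move=> c0; exists (c / pi ^ (v c)); last by rewrite divfK ?piX_neq0.
have w : v (c / pi ^ v c) = 0.
  by rewrite valuM ?invr_eq0 ?piX_neq0 // valuV ?piX_neq0 // val_piX subrr.
split; right; first by rewrite w.
by rewrite valuV ?w // mulf_neq0 ?invr_eq0 ?piX_neq0.
Qed.

Lemma val_ge0 N : val_ge v N 0.
Proof. by left. Qed.

Lemma val_geD N x y : val_ge v N x -> val_ge v N y -> val_ge v N (x + y).
Proof.
move=> [->|hx]; first by rewrite add0r.
move=> [->|hy]; first by rewrite addr0; right.
have [->|s0] := eqVneq (x + y) 0; first by left.
have [x0|x0] := eqVneq x 0; first by rewrite x0 add0r; right.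
have [y0|y0] := eqVneq y 0; first by rewrite y0 addr0; right.
right; apply: le_trans (_ : Num.min (v x) (v y) <= _).
  by rewrite le_min hx.
by case: Hv => _ h _; exact: h.
Qed.

Lemma val_geN N x : val_ge v N x -> val_ge v N (- x).
Proof. by move=> [->|h]; [left; rewrite oppr0|right; rewrite valuN]. Qed.

Lemma val_geM N M x y : val_ge v N x -> val_ge v M y -> val_ge v (N + M) (x * y).
Proof.
move=> [->|hx]; first by rewrite mul0r; left.
move=> [->|hy]; first by rewrite mulr0; left.
have [->|x0] := eqVneq x 0; first by rewrite mul0r; left.
have [->|y0] := eqVneq y 0; first by rewrite mulr0; left.
by right; rewrite valuM // lerD.
Qed.

Lemma val_geW N M x : M <= N -> val_ge v N x -> val_ge v M x.
Proof. by move=> h [->|?]; [left|right; exact: le_trans h _]. Qed.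

Lemma val_ge_sum N (I : Type) (r : seq I) (P : pred I) (E : I -> K) :
  (forall i, P i -> val_ge v N (E i)) -> val_ge v N (\sum_(i <- r | P i) E i).
Proof.
move=> h; elim/big_ind: _ => //; first exact: val_ge0.
by move=> x y; exact: val_geD.
Qed.

Lemma val_ge_piX N : val_ge v N (pi ^ N).
Proof. by right; rewrite val_piX. Qed.

Lemma integersD x y : integers v x -> integers v y -> integers v (x + y).
Proof. by move=> hx hy; apply: (val_geD hx hy). Qed.

Lemma integers0 : integers v 0.
Proof. by left. Qed.

Lemma integers1 : integers v 1.
Proof. by right; rewrite valu1. Qed.

Lemma integersN1 : integers v (-1).
Proof. by apply: val_geN; exact: integers1. Qed.

Lemma integersM x y : integers v x -> integers v y -> integers v (x * y).
Proof. by move=> /val_geM h /h; rewrite addr0. Qed.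

Lemma integers_piX (k : int) : 0 <= k -> integers v (pi ^ k).
Proof. by move=> k0; right; rewrite val_piX. Qed.

Lemma val_ge_pi N x : val_ge v N x -> exists2 a, integers v a & x = pi ^ N * a.
Proof.
move=> h; exists (pi ^ (- N) * x); last first.
  by rewrite mulrA -expfzDr ?pi_neq0 // subrr expr0z mul1r.
by have := val_geM (val_ge_piX (- N)) h; rewrite addNr.
Qed.

Context (V : vectType K).
Implicit Types (B L M : set V) (u w : V).

Definition submodule B := [/\ B 0, forall u w, B u -> B w -> B (u + w)
  & forall c u, integers v c -> B u -> B (c *: u)].

Lemma submodN B u : submodule B -> B u -> B (- u).
Proof. by move=> [_ _ h] Bu; rewrite -scaleN1r; apply: h => //; exact: integersN1. Qed.

Lemma submodB B u w : submodule B -> B u -> B w -> B (u - w).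
Proof. by move=> hB Bu Bw; case: (hB) => _ h _; apply: h => //; exact: submodN. Qed.

Lemma submodD B u w : submodule B -> B u -> B w -> B (u + w).
Proof. by move=> [_ h _]; exact: h. Qed.

Lemma submodZ B c u : submodule B -> integers v c -> B u -> B (c *: u).
Proof. by move=> [_ _ h]; exact: h. Qed.

Lemma submod0 B : submodule B -> B 0.
Proof. by case. Qed.

Lemma submod_sum B (I : Type) (r : seq I) (P : pred I) (E : I -> V) :
  submodule B -> (forall i, P i -> B (E i)) -> B (\sum_(i <- r | P i) E i).
Proof.
move=> hB h; elim/big_ind: _ => //; first exact: submod0.
by move=> x y; exact: submodD.
Qed.

Lemma piX_scaleK (k : int) u : pi ^ k *: (pi ^ (- k) *: u) = u.
Proof. by rewrite scalerA -expfzDr ?pi_neq0 // subrr expr0z scale1r. Qed.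

Lemma piX_scaleNK (k : int) u : pi ^ (- k) *: (pi ^ k *: u) = u.
Proof. by rewrite scalerA -expfzDr ?pi_neq0 // addNr expr0z scale1r. Qed.

Lemma piX_scaleD (k l : int) u : pi ^ k *: (pi ^ l *: u) = pi ^ (k + l) *: u.
Proof. by rewrite scalerA -expfzDr ?pi_neq0. Qed.

Lemma submod_piX B (k l : int) u : submodule B -> k <= l ->
  B (pi ^ k *: u) -> B (pi ^ l *: u).
Proof.
move=> hB kl Bu; rewrite -(subrK k l) -piX_scaleD.
by apply: submodZ => //; apply: integers_piX; lia.
Qed.

Lemma submod_val B c (k : int) u : submodule B -> val_ge v k c ->
  B (pi ^ k *: u) -> B (c *: u).
Proof.
move=> hB /val_ge_pi[a ha ->] h.
by rewrite mulrC -scalerA; exact: submodZ.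
Qed.

Lemma submod_scale_val B c u : submodule B -> c != 0 ->
  B (c *: u) <-> B (pi ^ v c *: u).
Proof.
move=> hB c0; have [a [a1 a2] cE] := val_unit_part c0.
have a0 : a != 0 by apply: contra_neq c0 => a0; rewrite cE a0 mul0r.
split=> h; last by rewrite cE -scalerA; exact: submodZ.
have <- : a^-1 *: (c *: u) = pi ^ v c *: u; last by apply: submodZ.
have -> : c *: u = a *: (pi ^ v c *: u) by rewrite scalerA -cE.
by rewrite scalerK.
Qed.

Lemma submod_integral_span n (e : 'I_n -> V) : submodule (integral_span v e).
Proof.
split.
- by exists (fun=> 0); [move=> i; exact: integers0|rewrite big1 // => i _; rewrite scale0r].
- move=> _ _ [c hc ->] [d hd ->]; exists (fun i => c i + d i).
    by move=> i; exact: integersD.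
  by rewrite -big_split /=; apply: eq_bigr => i _; rewrite scalerDl.
- move=> a _ ha [c hc ->]; exists (fun i => a * c i).
    by move=> i; exact: integersM.
  by rewrite scaler_sumr; apply: eq_bigr => i _; rewrite scalerA.
Qed.

Definition absorbing_in (U : {vspace V}) B :=
  forall u, u \in U -> exists k : int, B (pi ^ k *: u).

Definition lineless B := forall u, (forall k : int, B (pi ^ k *: u)) -> u = 0.

(* The coordinate along e of the elements of B is either bounded below, which
   yields the last basis vector, or B contains the line of a limit of the
   normalised elements of B. *)
Lemma submodule_basis (Hc : val_complete v) (s : seq V) B : free s -> submodule B ->
  (forall u, B u -> u \in <<s>>%VS) -> absorbing_in <<s>>%VS B -> lineless B ->
  exists b : (size s).-tuple V, [/\ free b, <<b>>%VS = <<s>>%VS &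
     B = integral_span v (fun i => tnth b i)].
Proof.
elim: s B => [|e s IHs] B; rewrite /=.
  move=> _ hB Bs _ _; exists [tuple]; split; [exact: nil_free|by []|].
  apply/seteqP; split=> u /=.
    move/Bs; rewrite span_nil memv0 => /eqP ->.
    exact: submod0 (submod_integral_span _).
  by move=> [c _ ->]; rewrite big_ord0; exact: submod0.
rewrite free_cons => /andP[es frs] hB Bs Babs Bline.
have US u : u \in <<s>>%VS -> u \in <<e :: s>>%VS.
  by rewrite span_cons => h; apply: (subvP (addvSr _ _)).
have [||||b [frb bs {}IHs]] := IHs (B `&` [set u | u \in <<s>>%VS]) frs.
- split; first by split; [exact: submod0|exact: mem0v].
  + by move=> x y [? ?] [? ?]; split; [exact: submodD|exact: memvD].
  + by move=> c x hc [? ?]; split; [exact: submodZ|exact: memvZ].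
- by move=> u [].
- move=> u us; have [k Bk] := Babs u (US _ us).
  by exists k; split=> //; exact: memvZ.
- by move=> u h; apply: Bline => k; case: (h k).
(* [P] collects the valuations of the nonzero e-coordinates of elements of B. It is closed upwards,
   so it either has a least element or is all of Z. *)
pose P (k : int) := exists2 u, u \in <<s>>%VS & B (pi ^ k *: e + u).
have Pup i j : i <= j -> P i -> P j.
  move=> ij [u us Bu]; exists (pi ^ (j - i) *: u); first exact: memvZ.
  have -> : pi ^ j *: e + pi ^ (j - i) *: u = pi ^ (j - i) *: (pi ^ i *: e + u).
    by rewrite scalerDr piX_scaleD subrK.
  by apply: submodZ => //; apply: integers_piX; lia.
have P1 : exists i, P i.
  have [|k Bk] := Babs e; first by rewrite memv_span ?mem_head.
  by exists k, 0; [exact: mem0v|rewrite addr0].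
have dec u : u \in <<e :: s>>%VS -> exists c, exists2 w, w \in <<s>>%VS & u = c *: e + w.
  rewrite span_cons => /memv_addP[_ /vlineP[c ->]] [w ws ->].
  by exists c, w.
have [[i NPi]|allP] := pselect (exists i, ~ P i).
  (* An element of B whose e-coordinate has the least valuation m completes a basis of the part of B
     inside [<<s>>]. *)
  have [m [[w ws Bw] NPm]] := int_threshold Pup P1 (ex_intro _ i NPi).
  pose b0 := pi ^ m *: e + w.
  have eb0 : e = pi ^ (- m) *: (b0 - w) by rewrite addrK piX_scaleNK.
  have b0s : b0 \notin <<s>>%VS.
    apply: contra es => h; rewrite eb0.
    by apply: memvZ; exact: memvB.
  exists [tuple of b0 :: b]; split.
  - by rewrite free_cons frb bs b0s.
  - rewrite !span_cons bs; apply/eqP; rewrite eqEsubv; apply/andP; split.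
      rewrite subv_add addvSr andbT -memvE.
      by rewrite memvD // ?(memvZ _ (subvP (addvSl _ _) _ (memv_line _))) // (subvP (addvSr _ _)).
    rewrite subv_add addvSr andbT -memvE eb0.
    by rewrite memvZ // memvB // ?(subvP (addvSl _ _) _ (memv_line _)) // (subvP (addvSr _ _)).
  - apply/seteqP; split=> u /=; last first.
      move=> [c hc ->]; apply: submod_sum => // j _; apply: submodZ => //.
      case: (unliftP ord0 j) => [j'|] ->; last by [].
      rewrite tnthS.
      have : (B `&` [set u | u \in <<s>>%VS]) (tnth b j').
        rewrite IHs; exists (fun l => (l == j')%:R).
          by move=> l; case: eqP => _; [exact: integers1|exact: integers0].
        by rewrite (bigD1 j') //= eqxx scale1r big1 ?addr0 // => l /negPf ->; rewrite scale0r.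
      by case.
    move=> Bu; have [c [u' u's uE]] := dec _ (Bs _ Bu).
    have hc : val_ge v m c.
      have [->|c0] := eqVneq c 0; first by left.
      right; rewrite leNgt; apply/negP => lt.
      apply: NPm; apply: (Pup (v c)); first by lia.
      have [a [a1 a2] cE] := val_unit_part c0.
      have a0 : a != 0 by apply: contra_neq c0 => a0; rewrite cE a0 mul0r.
      exists (a^-1 *: u'); first exact: memvZ.
      have -> : pi ^ v c *: e + a^-1 *: u' = a^-1 *: u.
        have ceE : c *: e = a *: (pi ^ v c *: e) by rewrite scalerA -cE.
        by rewrite uE ceE scalerDr scalerK.
      exact: submodZ.
    have [a ha cE] := val_ge_pi hc.
    have : (B `&` [set u | u \in <<s>>%VS]) (u - a *: b0).
      split; first by apply: submodB => //; exact: submodZ.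
      have -> : u - a *: b0 = u' - a *: w.
        by rewrite uE cE /b0 scalerDr opprD addrACA scalerA mulrC subrr add0r.
      by apply: memvB => //; exact: memvZ.
    rewrite IHs => -[d hd dE].
    exists (fun j => if unlift ord0 j is Some j' then d j' else a).
      by move=> j; case: unliftP.
    rewrite big_ord_recl unlift_none (tnth_nth 0) /=.
    apply/eqP; rewrite addrC -subr_eq; apply/eqP; rewrite dE.
    by apply: eq_bigr => j _; rewrite liftK tnthS.
have {}allP k : P k.
  by apply: contrapT => NPk; apply: allP; exists k.
exfalso.
(* As every valuation occurs, [e + u_ k] can be taken in pi^k B. Consecutive differences then lie in
   pi^k times the part of B inside [<<s>>], so the coordinates of [u_ k] are Cauchy. *)
have /choice[u_ hu] : forall k : nat, exists u, u \in <<s>>%VS /\ B (pi ^ (- k%:Z) *: (e + u)).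
  move=> k; have [w ws Bw] := allP (- k%:Z).
  exists (pi ^ k%:Z *: w); split; first exact: memvZ.
  by rewrite scalerDr piX_scaleNK.
have /choice[c_ hc] : forall k : nat, exists c : 'I_(size s) -> K,
    (forall i, integers v (c i)) /\
    pi ^ (- k%:Z) *: (u_ k.+1 - u_ k) = \sum_i c i *: tnth b i.
  move=> k; have : (B `&` [set u | u \in <<s>>%VS]) (pi ^ (- k%:Z) *: (u_ k.+1 - u_ k)).
    split; last by apply: memvZ; apply: memvB; [exact: (hu _).1|exact: (hu _).1].
    have -> : pi ^ (- k%:Z) *: (u_ k.+1 - u_ k) =
       pi *: (pi ^ (- k.+1%:Z) *: (e + u_ k.+1)) - pi ^ (- k%:Z) *: (e + u_ k).
      rewrite -[X in X *: (_ *: _)](expr1z pi) piX_scaleD.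
      have -> : 1 - k.+1%:Z = - k%:Z by lia.
      by rewrite -scalerBr opprD addrACA subrr add0r.
    apply: submodB => //; last exact: (hu _).2.
    apply: submodZ => //; last exact: (hu _).2.
    by rewrite -(expr1z pi); apply: integers_piX.
  by rewrite IHs => -[c h1 h2]; exists c.
pose S i (k : nat) := \sum_(j < k) pi ^ j%:Z * c_ j i.
have SB i (m n : nat) : (m <= n)%N -> val_ge v m%:Z (S i n - S i m).
  move=> /subnKC <-; elim: (n - m)%N => [|d IHd].
    by rewrite addn0 subrr; left.
  rewrite addnS /S big_ord_recr /= addrAC; apply: val_geD => //.
  have := val_geM (val_ge_piX (m + d)%N) ((hc (m + d)%N).1 i).
  by apply: val_geW; lia.
have /choice[l_ hl] : forall i, exists l, forall N, exists n0 : nat, forall n : nat,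
    (n0 <= n)%N -> val_ge v N (S i n - l).
  move=> i; apply: Hc => N.
  exists (`|N|)%N => m n hm hn.
  have [mn|/ltnW nm] := leqP m n.
    rewrite -opprB; apply: val_geN; apply: (val_geW _ (SB i _ _ mn)); lia.
  by apply: (val_geW _ (SB i _ _ nm)); lia.
have lS i (k : nat) : val_ge v k%:Z (l_ i - S i k).
  have [n0 h] := hl i k.
  have h1 := h (maxn n0 k) (leq_maxl _ _).
  have h2 := SB i k (maxn n0 k) (leq_maxr _ _).
  have -> : l_ i - S i k = (S i (maxn n0 k) - S i k) - (S i (maxn n0 k) - l_ i) by ring.
  by apply: val_geD => //; exact: val_geN.
have uS k : u_ k = u_ 0%N + \sum_i S i k *: tnth b i.
  elim: k => [|k IHk].
    by rewrite big1 ?addr0 // => i _; rewrite /S big_ord0 scale0r.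
  have := (hc k).2 => /(congr1 (fun x => pi ^ k%:Z *: x)).
  rewrite piX_scaleK scaler_sumr => h.
  rewrite -(subrK (u_ k) (u_ k.+1)) h addrC {1}IHk -addrA; congr (_ + _).
  rewrite -big_split /=; apply: eq_bigr => i _.
  by rewrite /S big_ord_recr /= scalerA -scalerDl.
pose u := u_ 0%N + \sum_i l_ i *: tnth b i.
have us : u \in <<s>>%VS.
  apply: memvD; first exact: (hu _).1.
  by apply: memv_suml => i _; apply: memvZ; rewrite -bs memv_span ?mem_tnth.
have euB (k : nat) : B (pi ^ (- k%:Z) *: (e + u)).
  have -> : pi ^ (- k%:Z) *: (e + u) = pi ^ (- k%:Z) *: (e + u_ k) + pi ^ (- k%:Z) *: (u - u_ k).
    by rewrite -scalerDr -addrA [u_ k + _]addrC subrK.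
  apply: submodD => //; first exact: (hu _).2.
  have : (B `&` [set u | u \in <<s>>%VS]) (pi ^ (- k%:Z) *: (u - u_ k)); last by case.
  rewrite IHs /u (uS k) opprD addrACA subrr add0r -sumrB.
  exists (fun i => pi ^ (- k%:Z) * (l_ i - S i k)).
    move=> i; have := val_geM (val_ge_piX (- k%:Z)) (lS i k).
    by rewrite addNr.
  by rewrite scaler_sumr; apply: eq_bigr => i _; rewrite -scalerBl scalerA.
(* In the limit [e + u] lies in every pi^k B, hence vanishes, which puts [e] in [<<s>>]. *)
have /Bline/eqP : forall k : int, B (pi ^ k *: (e + u)).
  move=> k; apply: (submod_piX hB _ (euB (`|k|)%N)); lia.
rewrite addr_eq0 => /eqP eu; move/negP: es; apply.
by rewrite eu memvN.
Qed.

End Valuation.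


(** A subspace of largest dimension inside D exhausts D. This turns predicates into subspaces to
    which irreducibility applies. *)
Lemma exists_vspace (k : fieldType) (V : vectType k) (D : set V) :
  D 0 -> (forall c u w, D u -> D w -> D (c *: u + w)) ->
  exists U : {vspace V}, forall u, (u \in U) <-> D u.
Proof.
move=> D0 Dlin.
pose P n := `[< exists2 U : {vspace V}, \dim U = n & forall u, u \in U -> D u >].
have P0 : exists n, P n.
  exists 0%N; apply/asboolP; exists 0%VS; first exact: dimv0.
  by move=> u; rewrite memv0 => /eqP ->.
have Pb n : P n -> (n <= \dim {:V})%N.
  by move=> /asboolP[U <- _]; apply: dimvS; exact: subvf.
case: (ex_maxnP P0 Pb) => n /asboolP[U dU UD] nmax.
exists U => u; split=> [|Du]; first exact: UD.
have : P (\dim (<[u]> + U)%VS).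
  apply/asboolP; exists (<[u]> + U)%VS => // _ /memv_addP[_ /vlineP[c ->] [w wU ->]].
  by apply: Dlin => //; exact: UD.
move=> /nmax; rewrite -dU => h.
have -> : U = (<[u]> + U)%VS.
  by apply/eqP; rewrite eqEdim addvSr h.
by apply: (subvP (addvSl _ _)); exact: memv_line.
Qed.

(** * Lattices without bases, stable lattices, and periods of chains *)

Section Lattices.
Context (K : fieldType) (v : K -> int) (Hv : discrete_valuation v).
Context (Hc : val_complete v).
Context (pi : K) (Hpi : uniformiser v pi).
Context (V : vectType K).
Implicit Types (A B L M : set V) (u w : V).

(** Basis-free form of [lattice]: a submodule between two lattices inherits these conditions at
    once, whereas a basis of it would have to be constructed. *)
Definition is_lattice B := [/\ submodule v B,
  forall u, exists k : int, B (pi ^ k *: u) & lineless pi B].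

Lemma free_basis (b : (\dim {:V}).-tuple V) : free b = basis_of {:V} b.
Proof. by rewrite basisEfree subvf size_tuple leqnn !andbT. Qed.

Lemma apartment_latticeP (b : (\dim {:V}).-tuple V) (a : 'I_(\dim {:V}) -> int) u :
  free b -> apartment_lattice v pi b a u <-> forall i, val_ge v (a i) (coord b i u).
Proof.
move=> frb; have bb : basis_of {:V} b by rewrite -free_basis.
split=> [[c hc ->] i|h].
  have -> : \sum_i c i *: (pi ^ a i *: tnth b i) = \sum_i (c i * pi ^ a i) *: b`_i.
    by apply: eq_bigr => j _; rewrite scalerA (tnth_nth 0).
  rewrite coord_sum_free //.
  by have := val_geM Hv (hc i) (val_ge_piX Hv Hpi (a i)); rewrite add0r.
exists (fun i => pi ^ (- a i) * coord b i u).
  move=> i; have := val_geM Hv (val_ge_piX Hv Hpi (- a i)) (h i).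
  by rewrite addNr.
rewrite {1}(coord_basis bb (memvf u)); apply: eq_bigr => i _.
rewrite scalerA mulrAC -(expfzDr _ _ (pi_neq0 Hpi)) addNr expr0z mul1r.
by rewrite (tnth_nth 0).
Qed.

Lemma integral_span_coord (b : (\dim {:V}).-tuple V) u :
  free b -> integral_span v (fun i => tnth b i) u <-> forall i, integers v (coord b i u).
Proof.
move=> frb; rewrite -(apartment_latticeP (fun=> 0) _ frb).
suff -> : apartment_lattice v pi b (fun=> 0) = integral_span v (fun i => tnth b i) by [].
by congr integral_span; apply/funext => i; rewrite expr0z scale1r.
Qed.

Lemma latticeP L : lattice v L <-> is_lattice L.
Proof.
split=> [[b frb ->]|[hL Labs Lline]].
  have bb : basis_of {:V} b by rewrite -free_basis.
  split; first exact: submod_integral_span.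
    move=> u; pose k : int := \sum_i `|v (coord b i u)|.
    exists k; apply/integral_span_coord => // i; rewrite linearZ /=.
    have [->|c0] := eqVneq (coord b i u) 0; first by rewrite mulr0; left.
    right; rewrite (valuM Hv) ?(piX_neq0 Hpi) // (val_piX Hv Hpi).
    have : `|v (coord b i u)| <= k.
      by rewrite /k (bigD1 i) //= lerDl sumr_ge0.
    by lia.
  move=> u hu; rewrite (coord_basis bb (memvf u)) big1 // => i _.
  have [->|c0] := eqVneq (coord b i u) 0; first by rewrite scale0r.
  (* This power of pi gives the i-th coordinate valuation -1, which is not integral. *)
  have /(integral_span_coord _ frb)/(_ i) := hu (- v (coord b i u) - 1).
  rewrite linearZ /= => -[/eqP|].
    by rewrite mulf_eq0 (negPf c0) (negPf (piX_neq0 Hpi _)).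
  by rewrite (valuM Hv) ?(piX_neq0 Hpi) // (val_piX Hv Hpi); lia.
have bb := vbasisP {:V}.
have [|||||b [frb bs LE]] := @submodule_basis _ _ Hv _ Hpi V Hc (vbasis {:V}) L.
- by case/andP: bb.
- by [].
- by move=> u _; rewrite (span_basis bb) memvf.
- by move=> u _; exact: Labs.
- by [].
have sz : size (vbasis {:V}) = \dim {:V} by rewrite size_tuple.
have [t tb] : exists t : (\dim {:V}).-tuple V, tval t = tval b.
  by have szb : size b == \dim {:V}; [rewrite size_tuple sz|exists (Tuple szb)].
exists t; first by rewrite tb.
rewrite LE; apply/seteqP; split=> u [c hc ->].
  exists (fun i => c (cast_ord (esym sz) i)) => //.
  rewrite (reindex (cast_ord sz)) /=; last first.
    by exists (cast_ord (esym sz)) => i _; rewrite ?cast_ordK ?cast_ordKV.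
  by apply: eq_bigr => i _; rewrite cast_ordK !(tnth_nth 0) tb.
exists (fun i => c (cast_ord sz i)) => //.
rewrite (reindex (cast_ord (esym sz))) /=; last first.
  by exists (cast_ord sz) => i _; rewrite ?cast_ordK ?cast_ordKV.
by apply: eq_bigr => i _; rewrite cast_ordKV !(tnth_nth 0) tb.
Qed.

Lemma dilateP c L u : c != 0 -> dilate c L u <-> L (c^-1 *: u).
Proof.
move=> c0; split=> [[w Lw <-]|h]; first by rewrite scalerK.
by exists (c^-1 *: u) => //; rewrite scalerKV.
Qed.

(** This is pi^k L. Every homothety acts on a submodule as such a power ([dilate_shift]), so a
    homothety class is an orbit of Z. *)
Definition shift (k : int) L := [set u | L (pi ^ (- k) *: u)].

Lemma shiftE k L : shift k L = dilate (pi ^ k) L.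
Proof.
by apply/seteqP; split=> u; rewrite (dilateP _ _ (piX_neq0 Hpi k)) invr_expz.
Qed.

Lemma shift1 L : shift 1 L = dilate pi L.
Proof. by rewrite shiftE expr1z. Qed.

Lemma shift0 L : shift 0 L = L.
Proof. by apply/seteqP; split=> u; rewrite /shift /= oppr0 expr0z scale1r. Qed.

Lemma shiftD k l L : shift k (shift l L) = shift (k + l) L.
Proof.
by apply/seteqP; split=> u; rewrite /shift /= (piX_scaleD Hpi) opprD addrC.
Qed.

Lemma shiftK k L : shift (- k) (shift k L) = L.
Proof. by rewrite shiftD addNr shift0. Qed.

Lemma shiftKV k L : shift k (shift (- k) L) = L.
Proof. by rewrite shiftD subrr shift0. Qed.

Lemma shiftS k A B : A `<=` B -> shift k A `<=` shift k B.
Proof. by move=> AB u; exact: AB. Qed.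

Lemma shift_le (k l : int) B : submodule v B -> k <= l -> shift l B `<=` shift k B.
Proof. by move=> hB kl u; apply: (submod_piX Hv Hpi hB); lia. Qed.

Lemma dilate_shift c L : submodule v L -> c != 0 -> dilate c L = shift (v c) L.
Proof.
move=> hL c0.
have c'0 : c^-1 != 0 by rewrite invr_eq0.
have h u := submod_scale_val Hv Hpi u hL c'0.
rewrite (valuV Hv) // in h.
by apply/seteqP; split=> u; rewrite (dilateP _ _ c0) /shift /= => /h.
Qed.

Lemma homothety_shift k L : homothety_class L (shift k L).
Proof. by exists (pi ^ k); [exact: (piX_neq0 Hpi)|rewrite shiftE]. Qed.

Lemma homothety_classP L L' : submodule v L ->
  homothety_class L L' <-> exists k, L' = shift k L.
Proof.
move=> hL; split=> [[c c0 <-]|[k ->]]; last exact: homothety_shift.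
by exists (v c); exact: dilate_shift.
Qed.

Lemma submod_shift k B : submodule v B -> submodule v (shift k B).
Proof.
move=> hL; split; rewrite /shift /=; first by rewrite scaler0; exact: submod0 hL.
  by move=> x y hx hy; rewrite scalerDr; exact: submodD hL hx hy.
by move=> c x hc' hx; rewrite scalerA mulrC -scalerA; exact: submodZ hL hc' hx.
Qed.

Lemma homothety_class_shift k L : submodule v L ->
  homothety_class (shift k L) = homothety_class L.
Proof.
move=> hL; have hL' : submodule v (shift k L) by exact: submod_shift.
apply/seteqP; split=> B /homothety_classP-/(_ _)[] // l ->.
  by apply/homothety_classP => //; rewrite shiftD; eexists.
by apply/homothety_classP => //; exists (l - k); rewrite shiftD subrK.
Qed.

Lemma homothety_class_id L : homothety_class L L.
Proof.
exists 1; first exact: oner_neq0.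
by apply/seteqP; split=> u; rewrite dilateP ?oner_neq0 // invr1 scale1r.
Qed.

Lemma homothety_class_eq L L' : submodule v L ->
  homothety_class L = homothety_class L' -> exists k, L' = shift k L.
Proof.
by move=> hL h; apply/homothety_classP => //; rewrite h; exact: homothety_class_id.
Qed.

Definition addm A B := [set u | exists a b, [/\ A a, B b & u = a + b]].

Lemma submod_addm A B : submodule v A -> submodule v B -> submodule v (addm A B).
Proof.
move=> hA hB; split.
- by exists 0, 0; split; [exact: submod0 hA|exact: submod0 hB|rewrite addr0].
- move=> _ _ [a [b [? ? ->]]] [a' [b' [? ? ->]]]; exists (a + a'), (b + b').
  by split; [exact: submodD hA _ _|exact: submodD hB _ _|rewrite addrACA].
- move=> c _ hc' [a [b [? ? ->]]]; exists (c *: a), (c *: b).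
  by split; [exact: submodZ hA _ _|exact: submodZ hB _ _|rewrite scalerDr].
Qed.

Lemma addmSl A B : submodule v B -> A `<=` addm A B.
Proof. by move=> hB u Au; exists u, 0; split=> //; [exact: submod0 hB|rewrite addr0]. Qed.

Lemma addmSr A B : submodule v A -> B `<=` addm A B.
Proof. by move=> hA u Au; exists 0, u; split=> //; [exact: submod0 hA|rewrite add0r]. Qed.

Lemma addm_sub A B C : submodule v C -> A `<=` C -> B `<=` C -> addm A B `<=` C.
Proof. by move=> hC AC BC _ [a [b [/AC ? /BC ? ->]]]; exact: submodD hC _ _. Qed.

Lemma submod_setI A B : submodule v A -> submodule v B -> submodule v (A `&` B).
Proof.
move=> hA hB; split.
- by split; [exact: submod0 hA|exact: submod0 hB].
- by move=> u w [? ?] [? ?]; split; [exact: submodD hA _ _|exact: submodD hB _ _].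
- by move=> c u hc' [? ?]; split; [exact: submodZ hA _ _|exact: submodZ hB _ _].
Qed.

Lemma lattice_submod B : is_lattice B -> submodule v B.
Proof. by case. Qed.

Lemma lattice_sandwich A B C : is_lattice A -> is_lattice C -> submodule v B ->
  A `<=` B -> B `<=` C -> is_lattice B.
Proof.
move=> [_ Aabs _] [_ _ Cline] hB AB BC; split=> //.
  by move=> u; have [k /AB] := Aabs u; exists k.
by move=> u h; apply: Cline => k; exact: BC.
Qed.

Lemma lattice_shift k B : is_lattice B -> is_lattice (shift k B).
Proof.
move=> [hB Babs Bline]; split; first exact: submod_shift.
  move=> u; have [l Bl] := Babs u; exists (k + l).
  by rewrite /shift /= (piX_scaleD Hpi) addKr.
move=> u h; apply: Bline => l; have := h (k + l).
by rewrite /shift /= (piX_scaleD Hpi) addKr.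
Qed.

Lemma lattice_comm A B : is_lattice A -> is_lattice B ->
  exists k, shift k A `<=` B.
Proof.
move=> /latticeP[b frb ->] [hB Babs _].
have /choice[k_ hk] : forall i, exists k : int, B (pi ^ k *: tnth b i).
  by move=> i; exact: Babs.
pose k : int := \sum_i `|k_ i|.
exists k => u [c hc' cE].
have -> : u = \sum_i c i *: (pi ^ k *: tnth b i).
  rewrite -(piX_scaleK Hpi k u) cE scaler_sumr; apply: eq_bigr => i _.
  by rewrite !scalerA mulrC.
apply: (submod_sum _ hB) => i _; apply: (submodZ hB (hc' i)).
apply: (submod_piX Hv Hpi hB _ (hk i)).
have : `|k_ i| <= k by rewrite /k (bigD1 i) //= lerDl sumr_ge0.
by lia.
Qed.

Lemma lattice_setI A B : is_lattice A -> is_lattice B -> is_lattice (A `&` B).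
Proof.
move=> hA hB; have [k kAB] := lattice_comm hA hB.
apply: (lattice_sandwich (lattice_shift (Num.max k 0) hA) hA) => //.
  by apply: submod_setI; exact: lattice_submod.
move=> u h; split.
  rewrite -(shift0 A); apply: shift_le h; first exact: lattice_submod.
  by rewrite le_max lexx orbT.
apply: kAB; apply: shift_le h; first exact: lattice_submod.
by rewrite le_max lexx.
Qed.

Lemma lattice_addm A B : is_lattice A -> is_lattice B -> is_lattice (addm A B).
Proof.
move=> hA hB; have [k kAB] := lattice_comm hA hB.
apply: (lattice_sandwich hA (lattice_shift (Num.min (- k) 0) hB)).
- by apply: submod_addm; exact: lattice_submod.
- by apply: addmSl; exact: lattice_submod.
- apply: addm_sub; first by apply: submod_shift; exact: lattice_submod.
    rewrite -{1}(shiftK k A) => u /(shiftS kAB); apply: shift_le.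
      exact: lattice_submod.
    by rewrite ge_min lexx.
  rewrite -{1}(shift0 B); apply: shift_le; first exact: lattice_submod.
  by rewrite ge_min lexx orbT.
Qed.

(** A lattice inside pi L would be closed under division by pi and contain the line of each of its
    vectors. *)
Lemma lattice_shift_proper L : {:V}%VS <> 0%VS -> is_lattice L -> ~ L `<=` shift 1 L.
Proof.
move=> V0 [hL Labs Lline] LL; apply: V0; apply/eqP; rewrite -subv0; apply/subvP => u _.
have [k Lk] := Labs u; rewrite memv0; apply/eqP/Lline.
have Ln (n : nat) : L (pi ^ (k - n%:Z) *: u).
  elim: n => [|n /LL]; first by rewrite subr0.
  rewrite /shift /= (piX_scaleD Hpi); congr (L (pi ^ _ *: u)); lia.
move=> l; apply: (submod_piX Hv Hpi hL _ (Ln (`|k - l|)%N)); lia.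
Qed.

Context (G : groupType) (rho : G -> 'End(V)).

Definition gstable B := forall g u, B u -> B (rho g u).

Definition is_slattice B := is_lattice B /\ gstable B.

Lemma slatticeP B : stable_lattice v rho B <-> is_slattice B.
Proof. by split=> -[/latticeP h1 h2]; split=> //; apply/latticeP. Qed.

Lemma slattice_lat B : is_slattice B -> is_lattice B.
Proof. by case. Qed.

Lemma slattice_submod B : is_slattice B -> submodule v B.
Proof. by case=> -[]. Qed.

Lemma slattice_shift k B : is_slattice B -> is_slattice (shift k B).
Proof.
move=> [h s]; split; first exact: lattice_shift.
by move=> g u /(s g); rewrite linearZ.
Qed.

Lemma slattice_setI A B : is_slattice A -> is_slattice B -> is_slattice (A `&` B).
Proof.
move=> [hA sA] [hB sB]; split; first exact: lattice_setI.
by move=> g u [? ?]; split; [exact: sA|exact: sB].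
Qed.

Lemma slattice_addm A B : is_slattice A -> is_slattice B -> is_slattice (addm A B).
Proof.
move=> [hA sA] [hB sB]; split; first exact: lattice_addm.
move=> g _ [a [b [? ? ->]]]; exists (rho g a), (rho g b).
by split; [exact: sA|exact: sB|rewrite linearD].
Qed.

Lemma slattice_class L L' : is_slattice L -> homothety_class L L' -> is_slattice L'.
Proof.
move=> hL /(homothety_classP _ (slattice_submod hL))[k ->].
exact: slattice_shift.
Qed.

Lemma X_verticesP L : X_vertices v rho (homothety_class L) <-> is_slattice L.
Proof.
split=> [[L' /slatticeP hL' E]|hL]; last by exists L => //; exact/slatticeP.
by apply: (slattice_class hL'); rewrite E; exact: homothety_class_id.
Qed.

(* By irreducibility, the lines contained in a stable submodule B form a stable
   subspace, which is zero unless B is everything. *)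
Lemma slattice_union (Hirr : irreducible rho) B A x0 : is_lattice A -> A `<=` B ->
  submodule v B -> gstable B -> ~ B x0 -> is_slattice B.
Proof.
move=> [_ Aabs _] AB hB sB Bx0; split=> //; split=> //.
  by move=> u; have [k /AB] := Aabs u; exists k.
have [||U UP] := @exists_vspace _ V [set u | forall k : int, B (pi ^ k *: u)].
- by move=> k; rewrite scaler0; exact: submod0 hB.
- move=> c u w hu hw k; rewrite scalerDr scalerA; apply: (submodD hB _ (hw k)).
  have [->|c0] := eqVneq c 0; first by rewrite mulr0 scale0r; exact: submod0 hB.
  apply: (submod_val Hv Hpi hB _ (hu (k + v c))); right.
  by rewrite (valuM Hv) ?(piX_neq0 Hpi) // (val_piX Hv Hpi).
case: Hirr => _ /(_ U)[].
- move=> g; apply/subvP => _ /memv_imgP[u /UP hu ->]; apply/UP => k.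
  by rewrite /= -linearZ; apply: sB; exact: hu.
- by move=> U0 u /UP; rewrite U0 memv0 => /eqP.
- move=> UT; have /UP/(_ 0) : x0 \in U by rewrite UT memvf.
  by rewrite expr0z scale1r.
Qed.

Lemma exists_maximal (Hirr : irreducible rho) A x0 : is_slattice A -> ~ A x0 ->
  exists M, [/\ is_slattice M, A `<=` M, ~ M x0 &
    forall M', is_slattice M' -> ~ M' x0 -> M `<=` M' -> M' = M].
Proof.
move=> hA Ax0.
pose good B := [/\ is_slattice B, A `<=` B & ~ B x0].
(* [Zorn_bigcup] includes the empty chain, whose union is empty; [set0] is adjoined for it, and
   ruled out as the maximal element by comparison with [A]. *)
have [|M [PM Mmax]] := @Zorn_bigcup V [set B | good B \/ B = set0].
  move=> F FP Ftot.
  have [[B0 [FB0 gB0]]|noB] := pselect (exists B, F B /\ good B); last first.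
    right; apply/seteqP; split=> // u [B FB Bu].
    have [gB|B_0] := FP _ FB; first by case: noB; exists B.
    by rewrite B_0 in Bu.
  have gF B u : F B -> B u -> good B.
    by move=> FB Bu; have [//|B_0] := FP _ FB; rewrite B_0 in Bu.
  left; case: (gB0) => hB0 AB0 B0x0.
  have AF : A `<=` \bigcup_(X in F) X by move=> u /AB0 ?; exists B0.
  have Fx0 : ~ (\bigcup_(X in F) X) x0.
    by move=> [B FB Bx0]; have [_ _] := gF _ _ FB Bx0; apply.
  split=> //; apply: (slattice_union Hirr (slattice_lat hA) AF _ _ Fx0).
    split.
    - by exists B0 => //; exact: submod0 (slattice_submod hB0).
    - move=> u w [B FB Bu] [C FC Cw].
      have [hB _ _] := gF _ _ FB Bu; have [hC _ _] := gF _ _ FC Cw.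
      have [BC|CB] := Ftot _ _ FB FC.
        by exists C => //; apply: (submodD (slattice_submod hC) _ Cw); exact: BC.
      by exists B => //; apply: (submodD (slattice_submod hB) Bu); exact: CB.
    - move=> c u hc' [B FB Bu]; have [hB _ _] := gF _ _ FB Bu.
      by exists B => //; exact: submodZ (slattice_submod hB) hc' Bu.
  move=> g u [B FB Bu]; have [[_ sB] _ _] := gF _ _ FB Bu.
  by exists B => //; exact: sB.
have gM : good M.
  case: PM => // M0; exfalso; apply: (Mmax A); last by left; split.
  rewrite M0; split=> //; move=> /(_ 0); apply.
  exact: submod0 (slattice_submod hA).
case: (gM) => hM AM Mx0; exists M; split=> // M' hM' M'x0 MM'.
apply: contrapT => neq; apply: (Mmax M').
  by split=> // M'M; apply: neq; apply/seteqP.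
by left; split=> //; exact: subset_trans MM'.
Qed.

(* One period of a pi-periodic chain of stable lattices. *)
Definition period N (A : nat -> set V) :=
  [/\ forall i, (i <= N)%N -> is_slattice (A i),
      forall i, (i < N)%N -> A i `<` A i.+1 & A 0%N = shift 1 (A N)].

Lemma period_le N (A : nat -> set V) i j : period N A -> (i <= j <= N)%N -> A i `<=` A j.
Proof.
move=> [_ h _] /andP[]; elim: j => [|j IHj].
  by rewrite leqn0 => /eqP -> _; exact: subset_refl.
rewrite leq_eqVlt => /orP[/eqP -> _|]; first exact: subset_refl.
rewrite ltnS => ij jN.
by apply: subset_trans (IHj ij (ltnW jN)) (properW (h _ jN)).
Qed.

Lemma period_vectors N (A : nat -> set V) : period N A -> exists x : 'I_N -> V,
  forall i : 'I_N, A i.+1 (x i) /\ ~ A i (x i).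
Proof.
move=> [_ h _].
have /choice[x hx] : forall i : 'I_N, exists x, A i.+1 x /\ ~ A i x.
  move=> i; have [_ /nonsubset[x [h1 h2]]] := h i (ltn_ord i).
  by exists x.
by exists x.
Qed.

(** Vectors x_i in A_{i+1} but not in A_i are linearly independent. In a relation, let c_l be the
    last among the coefficients of least valuation, and divide by it. The terms before l lie in A_l
    because their coefficients are integral; those after l do because their coefficients are
    divisible by pi and pi x_j lies in A_0. So x_l would lie in A_l. *)
Lemma period_free N (A : nat -> set V) : period N A -> (N <= \dim {:V})%N.
Proof.
move=> PA; have [x hx] := period_vectors PA.
suff fr : free [tuple x i | i < N].
  rewrite -[N](size_tuple [tuple x i | i < N]).
  by move: fr; rewrite /free => /eqP <-; apply: dimvS; exact: subvf.
apply/freeP => c c0 i; apply: contrapT => /eqP ci0.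
pose m := [arg min_(j < i | c j != 0) v (c j)]%O.
have [cm0 mmin] : c m != 0 /\ forall j, c j != 0 -> v (c m) <= v (c j).
  by rewrite /m; case: arg_minP => // j ? ?.
pose l := [arg max_(j > m | (c j != 0) && (v (c j) == v (c m))) (j : nat)].
have [cl0 vl lmax] : [/\ c l != 0, v (c l) = v (c m) &
    forall j, c j != 0 -> v (c j) = v (c m) -> (j <= l)%N].
  rewrite /l; case: arg_maxnP => /=; first by rewrite cm0 eqxx.
  move=> j /andP[? /eqP ?] hj; split=> // j' ? ?.
  by apply: hj; apply/andP; split=> //; apply/eqP.
have lN := ltn_ord l.
have hAl : submodule v (A l) by case: PA => h _ _; apply: slattice_submod; apply: h; exact: ltnW.
apply: (hx l).2.
have -> : x l = - \sum_(j | j != l) (c j / c l) *: x j.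
  apply/eqP; rewrite -addr_eq0; apply/eqP.
  apply: (scalerI cl0); rewrite scaler0 -[RHS]c0 [RHS](bigD1 l) //= scalerDr.
  congr (_ + _); first by rewrite (nth_map l) ?size_enum_ord // nth_ord_enum.
  rewrite scaler_sumr; apply: eq_bigr => j _.
  by rewrite (nth_map l) ?size_enum_ord // nth_ord_enum scalerA mulrC divfK.
apply: (submodN Hv hAl); apply: (submod_sum _ hAl) => j jl.
have [->|cj0] := eqVneq (c j) 0; first by rewrite mul0r scale0r; exact: submod0 hAl.
have vE : v (c j / c l) = v (c j) - v (c l).
  by rewrite (valuM Hv) ?invr_eq0 // (valuV Hv).
have := mmin _ cj0; rewrite -vl => vlj.
have [lj|jl'] := ltnP l j; last first.
  apply: (submodZ hAl); first by right; rewrite vE; lia.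
  apply: (period_le PA _ (hx j).1); rewrite (ltnW lN) andbT.
  by rewrite ltn_neqAle jl' andbT.
apply: (submod_val Hv Hpi hAl (k := 1)).
  right; rewrite vE.
  have : v (c j) != v (c l).
    by apply/eqP => e; have := lmax j cj0; rewrite e vl leqNgt lj => /(_ erefl).
  lia.
have : A 0%N (pi ^ 1 *: x j).
  case: (PA) => _ _ ->; rewrite /shift /= (piX_scaleNK Hpi).
  apply: (period_le PA _ (hx j).1).
  by have := ltn_ord j; lia.
by apply: (period_le PA); exact: ltnW.
Qed.

(** As pi x_i lies in A_0, a lattice containing A_0 avoids x_i exactly when it is normalised at pi
    x_i. If M_j = pi^k M_i with k > 0, then pi x_i in M_j gives x_i in M_i. If M_i = M_j with i < j,
    then x_i lies in A_j, hence in M_j = M_i. *)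
Lemma period_X_max (Hirr : irreducible rho) N (A : nat -> set V) : period N A ->
  `I_N #<= X_max v pi rho.
Proof.
move=> PA; have [x hx] := period_vectors PA.
have /choice[M hM] : forall i : 'I_N, exists M, [/\ is_slattice M, A i `<=` M, ~ M (x i) &
    forall M', is_slattice M' -> ~ M' (x i) -> M `<=` M' -> M' = M].
  move=> i; apply: (exists_maximal Hirr _ (hx i).2).
  by case: PA => h _ _; apply: h; exact: ltnW.
have A0x i : A 0%N (pi *: x i).
  case: (PA) => _ _ ->; rewrite /shift /= -[X in _ *: (X *: _)](expr1z pi) (piX_scaleNK Hpi).
  by apply: (period_le PA _ (hx i).1); have := ltn_ord i; lia.
have Mx (i j : 'I_N) : M i (pi *: x j).
  have [_ AM _ _] := hM i; apply/AM/(period_le PA _ (A0x j)).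
  by have := ltn_ord i; lia.
have dilx (B : set V) w : dilate pi B (pi *: w) <-> B w.
  by rewrite dilateP ?(pi_neq0 Hpi) // scalerK ?(pi_neq0 Hpi).
have maxM i : X_max v pi rho (homothety_class (M i)).
  have [sM AM NMx Mmax] := hM i.
  exists (M i) => //; exists (pi *: x i).
    rewrite scaler_eq0 (negPf (pi_neq0 Hpi)) /=.
    by apply/eqP => x0; apply: NMx; rewrite x0; exact: submod0 (slattice_submod sM).
  split; first exact/slatticeP.
    by split; [exact: Mx|move/dilx].
  move=> L' /slatticeP sL' [L'x NL'x] ML'; apply: Mmax => //.
  by move=> h; apply: NL'x; apply/dilx.
have shM (i j : 'I_N) k : 0 < k -> M j <> shift k (M i).
  move=> k0 E; have [sM _ NMx _] := hM i.
  have := Mx j i; rewrite E => /(@shift_le 1 k _ (slattice_submod sM)).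
  rewrite shift1 => /(_ _)/dilx h; apply: NMx; apply: h; lia.
have injM (i j : 'I_N) : homothety_class (M i) = homothety_class (M j) -> i = j.
  have [sMi AMi NMi _] := hM i; have [sMj AMj NMj _] := hM j.
  move=> /(homothety_class_eq (slattice_submod sMi))[k E].
  have [k0|k0|k0] := ltrgtP k 0.
  - have := @shM j i (- k); rewrite E shiftK => /(_ _ erefl) [].
    by rewrite oppr_gt0.
  - by have := shM i j k k0.
  have {}E : M j = M i by rewrite E k0 shift0.
  apply/val_inj/eqP; rewrite /= eqn_leq; apply/andP; split; rewrite leqNgt; apply/negP => lt.
    apply: NMj; rewrite E; apply: AMi; apply: (period_le PA _ (hx j).1).
    by rewrite lt ltnW.
  apply: NMi; rewrite -E; apply: AMj; apply: (period_le PA _ (hx i).1).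
  by rewrite lt ltnW.
case: N => [|N] in A PA x hx M hM A0x Mx maxM shM injM *.
  by rewrite II0; exact: card_ge0.
pose f n := homothety_class (M (inord n)).
have finj : {in `I_N.+1 &, injective f}.
  move=> m n; rewrite !inE => hm hn /injM /(congr1 val) /=.
  by rewrite !inordK.
rewrite -(card_le_eql (inj_card_eq finj)).
by apply: subset_card_le => _ [n _ <-]; exact: maxM.
Qed.

Lemma face_period (Hirr : irreducible rho) n : X_has_face v pi rho n -> exists A : nat -> set V, period n.+1 A.
Proof.
move=> [x [L [hL hL0 hLij]] hx].
have sL i : is_slattice (L i).
  by have := hx i; rewrite (hL i).2 => /X_verticesP.
(* The largest lattice of the face ends the period and its multiple by pi begins it, so n + 1
   vertices give n + 1 steps. *)
exists (fun i => if i == 0%N then shift 1 (L ord0) else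
          if (i <= n)%N then L (inord i) else L ord0); split.
- move=> i _; case: ifP => _; first exact: slattice_shift.
  by case: ifP.
- move=> i; rewrite ltnS => ni; rewrite ni /=; case: eqP => [->|/eqP i0].
    have [n0|n0] := ltnP 0 n.
      by rewrite shift1; apply: (hL0 _ _).1; rewrite inordK.
    rewrite shift1; split.
      rewrite -shift1 -{2}(shift0 (L ord0)); apply: shift_le => //.
      exact: slattice_submod.
    by rewrite -shift1; apply: lattice_shift_proper; [case: Hirr|exact: slattice_lat].
  rewrite -lt0n in i0.
  have [lt|_] := ltnP i n.
    by apply: hLij; rewrite !inordK // ltnW.
  by apply: (hL0 _ _).2; rewrite inordK.
- by rewrite ltnn.
Qed.

End Lattices.


Lemma nat_threshold (P : nat -> Prop) N : P 0%N -> ~ P N ->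
  exists j, [/\ (j < N)%N, P j & ~ P j.+1].
Proof.
elim: N => [//|N IHN] P0 NPN.
have [PN|NP] := pselect (P N); first by exists N.
by have [j [jN Pj NPj]] := IHN P0 NP; exists j; split=> //; exact: ltnW.
Qed.

(* Schur: a linear correspondence between irreducibles that is total and
   has trivial fibres at 0 is the graph of an isomorphism. *)
Lemma isomorphic_of_rel (F : fieldType) (G : groupType) (W W' : vectType F)
    (sigma : G -> 'End(W)) (sigma' : G -> 'End(W')) (Rel : W -> W' -> Prop) :
  irreducible sigma -> irreducible sigma' ->
  (forall w, exists w', Rel w w') ->
  (forall c w1 w1' w2 w2', Rel w1 w1' -> Rel w2 w2' ->
     Rel (c *: w1 + w2) (c *: w1' + w2')) ->
  (forall w', Rel 0 w' -> w' = 0) -> (forall w, Rel w 0 -> w = 0) ->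
  (forall g w w', Rel w w' -> Rel (sigma g w) (sigma' g w')) ->
  isomorphic sigma sigma'.
Proof.
move=> [W0 _] [_ irr'] /choice[f hf] Rlin Rfun Rinj Req.
have Runiq w w1 w2 : Rel w w1 -> Rel w w2 -> w1 = w2.
  move=> h1 h2; have := Rlin (-1) _ _ _ _ h1 h2.
  rewrite !scaleN1r addNr => /Rfun/eqP; rewrite addrC subr_eq0 => /eqP.
  by [].
have flin : linear f.
  by move=> c x y; apply: Runiq (hf _) _; exact: Rlin.
pose fL : {linear W -> W'} := HB.pack f (GRing.isLinear.Build _ _ _ _ f flin).
have fE w : linfun fL w = f w by rewrite lfunE.
have ker0 : lker (linfun fL) = 0%VS.
  apply/eqP; rewrite -subv0; apply/subvP => w.
  rewrite memv_ker fE memv0 => /eqP fw0; apply/eqP/Rinj.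
  by rewrite -fw0.
exists (linfun fL); split=> //.
  case: (irr' (limg (linfun fL))) => // [g|].
    apply/subvP => _ /memv_imgP[_ /memv_imgP[w _ ->] ->].
    rewrite fE (Runiq _ _ _ (Req g _ _ (hf w)) (hf _)) -fE.
    by apply: memv_img; exact: memvf.
  move=> im0; case: W0; rewrite -ker0; apply/eqP; rewrite eqEsubv subvf andbT.
  apply/subvP => w _; rewrite memv_ker -memv0 -im0.
  by apply: memv_img; exact: memvf.
by move=> g x; rewrite !fE; apply: Runiq (hf _) _; exact: Req.
Qed.

(** * Maximal lattices and the simple factors of a periodic chain *)

Section Maximal.
Context (K : fieldType) (v : K -> int) (Hv : discrete_valuation v).
Context (Hc : val_complete v).
Context (pi : K) (Hpi : uniformiser v pi).
Context (V : vectType K) (G : groupType) (rho : G -> 'End(V)).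
Implicit Types (B L M : set V) (u : V).

Local Notation slat := (is_slattice v pi rho).
Local Notation "k >> A" := (shift pi k%R A) (at level 40).

Lemma period_lt N (A : nat -> set V) i j : period v pi rho N A -> (i < j <= N)%N ->
  A i `<` A j.
Proof.
move=> PA /andP[ij jN]; case: (PA) => _ h _.
have /h[s ns] : (i < N)%N by exact: leq_trans jN.
split; first by apply: (period_le PA); rewrite jN ltnW.
by move=> h'; apply: ns; apply: subset_trans h'; apply: (period_le PA); rewrite ij.
Qed.

Lemma period_face N (A : nat -> set V) : period v pi rho N.+1 A ->
  X_has_face v pi rho N.
Proof.
move=> PA; case: (PA) => sA _ A0.
pose L (i : 'I_N.+1) := A (if i == ord0 then N.+1 else i).
have LN (i : 'I_N.+1) : ((if i == ord0 then N.+1 else i : nat) <= N.+1)%N.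
  by case: ifP => // _; exact: ltnW (ltn_ord i).
exists (fun i => homothety_class (L i)); last first.
  by move=> i; exists (L i) => //; apply/(slatticeP Hv Hc Hpi); exact: sA.
exists L; split.
- by move=> i; split=> //; apply/(latticeP Hv Hc Hpi); apply: slattice_lat; apply: sA.
- move=> i i0; rewrite /L /= -(shift1 Hpi) -A0.
  have -> : (i == ord0) = false by apply/eqP => e; rewrite e in i0.
  split; apply: (period_lt PA); first by rewrite i0 ltnW.
  by rewrite ltn_ord leqnn.
- move=> i j i0 ij; rewrite /L /=.
  have -> : (i == ord0) = false by apply/eqP => e; rewrite e in i0.
  have -> : (j == ord0) = false by apply/eqP => e; rewrite e in ij.
  by apply: (period_lt PA); rewrite ij ltnW.
Qed.

(** The given lattice is a face of dimension 0 and [period_free] bounds all dimensions, so the [get]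
    in [X_dim] returns a maximum. *)
Lemma X_dimP (Hirr : irreducible rho) : (exists L, stable_lattice v rho L) ->
  X_has_face v pi rho (X_dim v pi rho) /\
  forall n, X_has_face v pi rho n -> (n <= X_dim v pi rho)%N.
Proof.
move=> [L sL].
have f0 : X_has_face v pi rho 0.
  exists (fun=> homothety_class L); last by move=> i; exists L.
  exists (fun=> L); split.
  - by move=> i; split=> //; case: sL.
  - by move=> i; rewrite (ord1 i).
  - by move=> i j; rewrite (ord1 i).
pose P n := `[< X_has_face v pi rho n >].
have eP : exists n, P n by exists 0%N; apply/asboolP.
have Pb n : P n -> (n <= \dim {:V})%N.
  move=> /asboolP /(face_period Hv Hc Hpi Hirr)[A /(period_free Hv Hpi)].
  exact: ltnW.
case: (ex_maxnP eP Pb) => d /asboolP fd dmax.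
apply: (@getPex _ [set d : nat | X_has_face v pi rho d /\
                     forall n, X_has_face v pi rho n -> (n <= d)%N]).
by exists d; split=> // n fn; apply: dmax; apply/asboolP.
Qed.

(** This is M+ whenever the intersection is itself strictly larger than M. *)
Definition plus M := [set u | forall B, slat B -> M `<=` B -> ~ B `<=` M -> B u].

(* Maximality only matters through the unique minimal stable lattice above M. *)
Definition meet_irreducible M := [/\ slat M, slat (plus M) & ~ plus M `<=` M].

Lemma plus_ge M : M `<=` plus M.
Proof. by move=> u Mu B _ MB _; exact: MB. Qed.

Lemma plus_le M B : slat B -> M `<=` B -> ~ B `<=` M -> plus M `<=` B.
Proof. by move=> h1 h2 h3 u; apply. Qed.

(** If M is maximal at x, then pi^-1 x lies outside M but, by maximality, in every stable lattice
    strictly above M. One of these is pi^-1 M, so M+ is squeezed between two lattices. *)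
Lemma maximal_meet_irreducible (Hirr : irreducible rho) M :
  maximal_lattice v pi rho M -> meet_irreducible M.
Proof.
move=> [x x0 [/(slatticeP Hv Hc Hpi) sM [Mx NMx] Mmax]].
have hM := slattice_submod sM.
have Mp : ~ plus M `<=` M.
  move=> h; apply: NMx; apply/dilateP; first exact: (pi_neq0 Hpi).
  apply: h => B sB MB NBM; apply: contrapT => NBx; apply: NBM.
  rewrite (Mmax B) //; first exact/(slatticeP Hv Hc Hpi).
  by split; [exact: MB|move/dilateP => /(_ (pi_neq0 Hpi))].
have s1 : slat ((-1) >> M) by exact: slattice_shift.
have M1 : M `<=` (-1) >> M.
  by rewrite -{1}(shift0 pi M); apply: (shift_le Hv Hpi).
have pM1 : plus M `<=` (-1) >> M.
  apply: plus_le => //; apply: contra_not (lattice_shift_proper Hv Hpi Hirr.1 (slattice_lat sM)).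
  by move=> /(@shiftS _ pi _ 1); rewrite (shiftKV Hpi).
split=> //; split.
  apply: (lattice_sandwich (slattice_lat sM) (slattice_lat s1) _ (@plus_ge M) pM1).
  split.
  - by move=> B /slattice_submod /submod0.
  - by move=> u w hu hw B sB h1 h2; apply: (submodD (slattice_submod sB)); [exact: hu|exact: hw].
  - by move=> c u hc hu B sB h1 h2; apply: (submodZ (slattice_submod sB) hc); exact: hu.
move=> g u hu B sB h1 h2; case: (sB) => _; apply; exact: hu.
Qed.

Lemma shift_subP k (A B : set V) : k >> A `<=` k >> B <-> A `<=` B.
Proof.
split=> [/(@shiftS _ pi _ (- k))|]; first by rewrite !(shiftK Hpi).
exact: shiftS.
Qed.

Lemma plus_shift k M : plus (k >> M) = k >> plus M.
Proof.
apply/seteqP; split=> u hu.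
  move=> B sB MB NBM; apply: (hu (k >> B)).
  - by apply: slattice_shift.
  - exact: shiftS.
  - by move/shift_subP.
move=> B sB MB NBM.
have h1 : slat ((- k) >> B) by exact: slattice_shift.
have h2 : M `<=` (- k) >> B by apply/(shift_subP k); rewrite (shiftKV Hpi).
have h3 : ~ ((- k) >> B `<=` M).
  by move=> h; apply: NBM; apply/(shift_subP (- k)); rewrite (shiftK Hpi).
by have := hu _ h1 h2 h3; rewrite /shift /= opprK (piX_scaleK Hpi).
Qed.

Lemma meet_irreducible_shift k M : meet_irreducible M -> meet_irreducible (k >> M).
Proof.
move=> [h1 h2 h3]; split; first exact: slattice_shift.
  by rewrite plus_shift; exact: slattice_shift.
by rewrite plus_shift => /shift_subP.
Qed.

Lemma exists_shift_le M B : slat M -> slat B -> exists k, k >> B `<=` M.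
Proof. by move=> [hM _] [hB _]; exact: (lattice_comm Hv Hc Hpi). Qed.

Lemma exists_shift_not_le (Hirr : irreducible rho) M B : slat M -> slat B ->
  exists k, ~ k >> B `<=` M.
Proof.
move=> hM hB; have [k kMB] := exists_shift_le hB hM.
exists (-1 - k) => h.
apply: (lattice_shift_proper Hv Hpi Hirr.1 (slattice_lat hM)).
have {}kMB : M `<=` (- k) >> B by rewrite -(shift_subP k) (shiftKV Hpi).
apply: subset_trans kMB _; move: h => /(@shiftS _ pi _ (1)).
by rewrite (shiftD Hpi); have -> : 1 + (-1 - k) = - k by lia.
Qed.

Context (F : fieldType) (red : K -> F) (Hred : residue_map v red).

(** Through representatives, [psi] identifies A'/A with [sigma]; its values outside A' are
    irrelevant. *)
Definition factor_map (A A' : set V) (W : vectType F) (sigma : G -> 'End(W))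
    (psi : V -> W) := [/\
  forall x y, A' x -> A' y -> psi (x + y) = psi x + psi y,
  forall c x, integers v c -> A' x -> psi (c *: x) = red c *: psi x,
  forall w, exists2 x, A' x & psi x = w,
  forall x, A' x -> (psi x = 0 <-> A x)
 & forall g x, A' x -> psi (rho g x) = sigma g (psi x)].

Lemma factor_map_shift k A A' (W : vectType F) (sigma : G -> 'End(W)) psi :
  factor_map A A' sigma psi ->
  factor_map (k >> A) (k >> A') sigma (fun u => psi (pi ^ (- k) *: u)).
Proof.
move=> [h1 h2 h3 h4 h5]; split.
- by move=> x y hx hy; rewrite scalerDr h1.
- by move=> c x hc hx; rewrite scalerA mulrC -scalerA h2.
- move=> w; have [x Ax <-] := h3 w; exists (pi ^ k *: x).
    by rewrite /shift /= (piX_scaleNK Hpi).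
  by rewrite (piX_scaleNK Hpi).
- by move=> x hx; exact: h4.
- by move=> g x hx; rewrite -linearZ h5.
Qed.

(** The image of C is a stable subspace of W, nonzero because C is not inside A. *)
Lemma factor_full A A' (W : vectType F) (sigma : G -> 'End(W)) psi C : irreducible sigma ->
  factor_map A A' sigma psi -> submodule v C -> gstable rho C -> C `<=` A' ->
  ~ C `<=` A -> forall w, exists2 x, C x & psi x = w.
Proof.
move=> [_ irr] [h1 h2 h3 h4 h5] hC sC CA' NCA.
case: (Hred) => _ _ redS _.
have [||U UP] := @exists_vspace _ W [set w | exists2 x, C x & psi x = w].
- exists 0; first exact: submod0 hC.
  have := h2 0 0 (integers0 v) (CA' _ (submod0 hC)).
  rewrite scale0r => ->.
  suff -> : red 0 = 0 by rewrite scale0r.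
  by case: (Hred) => _ _ _ /(_ 0 (integers0 v)) ->; left.
- move=> c _ _ [x Cx <-] [y Cy <-].
  have [d hd <-] := redS c; have Cdx : C (d *: x) := submodZ hC hd Cx.
  exists (d *: x + y); first exact: submodD hC Cdx Cy.
  by rewrite h1 ?h2 //; exact: CA'.
case: (irr U).
- move=> g; apply/subvP => _ /memv_imgP[w /UP[x Cx <-] ->]; apply/UP.
  by exists (rho g x); [exact: sC|rewrite h5 //; exact: CA'].
- move=> U0; exfalso; apply: NCA => x Cx; apply/h4; first exact: CA'.
  by apply/eqP; rewrite -memv0 -U0; apply/UP; exists x.
- by move=> U1 w; apply/UP; rewrite U1 memvf.
Qed.

Lemma factor_decomp A A' (W : vectType F) (sigma : G -> 'End(W)) psi C : submodule v A' ->
  irreducible sigma ->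
  factor_map A A' sigma psi -> submodule v C -> gstable rho C -> C `<=` A' ->
  ~ C `<=` A -> A' `<=` addm A C.
Proof.
move=> hA' irr fm hC sC CA' NCA u A'u.
have [x Cx xu] := factor_full irr fm hC sC CA' NCA (psi u).
case: fm => h1 h2 _ h4 _; have A'x := CA' _ Cx.
exists (u - x), x; split=> //; last by rewrite subrK.
have A'Nx : A' (- x) by exact: (submodN Hv hA' A'x).
apply/h4; first exact: (submodB Hv hA').
rewrite h1 // -scaleN1r h2 //; last exact: (integersN1 Hv).
suff -> : red (-1) = -1 by rewrite scaleN1r xu subrr.
case: (Hred) => r1 rD _ r0; apply/eqP; rewrite -subr_eq0 opprK -r1.
rewrite -(rD _ _ (integersN1 Hv) (integers1 Hv)).1 addNr; apply/eqP/r0.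
  exact: integers0.
by left.
Qed.

(** The filtration induced by the chain on P/Q becomes nonzero at the step from A to A'. If A'/A is
    simple and Q lies in P, all being stable, this embeds A'/A into P/Q. *)
Definition jump (A A' P Q : set V) := A `&` P `<=` Q /\ ~ (A' `&` P `<=` Q).

Lemma jump_sub A A' P Q : Q `<=` P -> jump A A' P Q -> ~ (A' `&` P `<=` A).
Proof.
move=> QP [h1 h2] h; apply: h2 => u [A'u Pu]; apply: h1; split=> //.
exact: h.
Qed.

(** Otherwise simplicity gives A' = A + (A' [&] Q), and A' [&] P would lie in Q. *)
Lemma jump_cap A A' P Q (W : vectType F) (sigma : G -> 'End(W)) psi : slat A' ->
  irreducible sigma -> factor_map A A' sigma psi -> slat P ->
  slat Q -> Q `<=` P -> jump A A' P Q -> A' `&` Q `<=` A.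
Proof.
move=> sA' irr fm sP sQ QP [h1 h2]; apply: contrapT => h; apply: h2 => u [A'u Pu].
have sC := slattice_setI Hv Hc Hpi sA' sQ.
have [a [q [Aa [A'q Qq] uE]]] :=
  factor_decomp (slattice_submod sA') irr fm (slattice_submod sC) sC.2
    (@subIsetl _ _ _) h A'u.
rewrite uE; apply: (submodD (slattice_submod sQ)) => //; apply: h1; split=> //.
have -> : a = u - q by rewrite uE addrK.
by apply: (submodB Hv (slattice_submod sP)) => //; exact: QP.
Qed.

(** The last hypothesis identifies P/Q with the first factor, and P2/(P2 [&] Q), where the second
    factor occurs, embeds into P/Q. The isomorphism is the graph of having representatives congruent
    modulo Q. *)
Lemma jump_isomorphic A1 A1' (W1 : vectType F) (sigma1 : G -> 'End(W1)) psi1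
    A2 A2' (W2 : vectType F) (sigma2 : G -> 'End(W2)) psi2 P Q P2 :
  irreducible sigma1 -> irreducible sigma2 ->
  slat A1' -> slat A2' -> slat P -> slat Q -> slat P2 -> Q `<=` P -> P2 `<=` P ->
  factor_map A1 A1' sigma1 psi1 -> factor_map A2 A2' sigma2 psi2 ->
  jump A1 A1' P Q -> jump A2 A2' P2 (P2 `&` Q) ->
  P `<=` addm Q (A1' `&` P) -> isomorphic sigma2 sigma1.
Proof.
move=> irr1 irr2 sA1 sA2 sP sQ sP2 QP P2P fm1 fm2 j1 j2 PQ.
have sQ2 := slattice_setI Hv Hc Hpi sP2 sQ.
have Q2P2 : P2 `&` Q `<=` P2 by exact: subIsetl.
have c1 := jump_cap sA1 irr1 fm1 sP sQ QP j1.
have c2 := jump_cap sA2 irr2 fm2 sP2 sQ2 Q2P2 j2.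
have sC := slattice_setI Hv Hc Hpi sA2 sP2.
have full := factor_full irr2 fm2 (slattice_submod sC) sC.2 (@subIsetl _ _ _)
  (jump_sub Q2P2 j2).
have hP := slattice_submod sP; have hQ := slattice_submod sQ.
have hP2 := slattice_submod sP2.
have hA1 := slattice_submod sA1; have hA2 := slattice_submod sA2.
case: (fm1) (fm2) => a1 a2 a3 a4 a5 [b1 b2 b3 b4 b5].
case: (Hred) => _ _ redS _.
apply: (@isomorphic_of_rel _ _ _ _ _ _ (fun w w' => exists x y,
   [/\ A2' x /\ P2 x, A1' y /\ P y, Q (x - y) & psi2 x = w /\ psi1 y = w'])) => //.
- move=> w; have [x [A2x P2x] <-] := full w.
  have [q [y [Qq [A1y Py] xE]]] := PQ _ (P2P _ P2x).
  by exists (psi1 y), x, y; split=> //; rewrite xE addrK.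
- move=> c _ _ _ _ [x [y [[? ?] [? ?] ? [<- <-]]]] [x' [y' [[? ?] [? ?] ? [<- <-]]]].
  have [d hd <-] := redS c.
  have ? : A2' (d *: x) by exact: submodZ hA2 hd _.
  have ? : A1' (d *: y) by exact: submodZ hA1 hd _.
  exists (d *: x + x'), (d *: y + y'); split.
  + split; first exact: submodD hA2 _ _.
    by apply: (submodD hP2) => //; exact: submodZ hP2 hd _.
  + split; first exact: submodD hA1 _ _.
    by apply: (submodD hP) => //; exact: submodZ hP hd _.
  + rewrite opprD addrACA -scalerBr; apply: (submodD hQ) => //.
    exact: submodZ hQ hd _.
  + by rewrite b1 // b2 // a1 // a2.
- move=> w' [x [y [[A2x P2x] [A1y Py] Qxy [x0 <-]]]].
  apply/a4 => //; apply: c1; split=> //.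
  have Qx : Q x by apply: (proj2 (j2.1 x _)); split=> //; apply/b4.
  have -> : y = x - (x - y) by rewrite opprB addrC subrK.
  exact: (submodB Hv hQ).
- move=> w [x [y [[A2x P2x] [A1y Py] Qxy [<- y0]]]].
  apply/b4 => //; apply: c2; split=> //; split=> //.
  have Qy : Q y by apply: j1.1; split=> //; apply/a4.
  by rewrite -(subrK y x); exact: submodD hQ _ _.
- move=> g w w' [x [y [[? ?] [? ?] ? [<- <-]]]].
  exists (rho g x), (rho g y); split.
  + by split; [exact: sA2.2|exact: sP2.2].
  + by split; [exact: sA1.2|exact: sP.2].
  + by rewrite -linearB; exact: sQ.2.
  + by rewrite b5 // a5.
Qed.

Context (Hirr : irreducible rho).
Context (N : nat) (A : nat -> set V) (PA : period v pi rho N A).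
Context (W : 'I_N -> vectType F) (sigma : forall i, G -> 'End(W i)).
Context (psi : forall i, V -> W i).
Context (Wirr : forall i, irreducible (sigma i)).
Context (Wiso : forall i j, isomorphic (sigma i) (sigma j) -> i = j).
Context (Afac : forall i : 'I_N, factor_map (A i) (A i.+1) (sigma i) (psi i)).

Let sA i : (i <= N)%N -> slat (A i).
Proof. by case: PA => h _ _; exact: h. Qed.

(** The scale k is a threshold along the multiples of A_0. One period above pi^k A_0 is pi^k A_N =
    pi^(k-1) A_0, so a second threshold, in j, finds the step. *)
Lemma jump_exists P Q : (exists k, (k >> A 0%N) `&` P `<=` Q) ->
  (exists k, ~ (k >> A 0%N) `&` P `<=` Q) ->
  exists k (j : 'I_N), jump (k >> A j) (k >> A j.+1) P Q.
Proof.
move=> e1 e2; have [|k [h1 h2]] := int_threshold _ e1 e2.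
  move=> i j ij h u [hu Pu]; apply: h; split=> //.
  by apply: (shift_le Hv Hpi _ ij hu); apply: slattice_submod; exact: sA.
have A0 : A 0%N = 1 >> A N by case: PA.
have [||j [jN j1 j2]] := @nat_threshold (fun j => (k >> A j) `&` P `<=` Q) N => //.
  by move: h2; rewrite A0 (shiftD Hpi) subrK.
by exists k, (Ordinal jN).
Qed.

(** The case of [jump_exists] where P is all of V. The index j is the label by which the maximal
    classes are counted. *)
Lemma label_exists M : slat M -> exists k (j : 'I_N),
  k >> A j `<=` M /\ ~ (k >> A j.+1 `<=` M).
Proof.
move=> sM; have [||k [j]] := @jump_exists setT M.
- by have [k h] := exists_shift_le sM (sA (leq0n N)); exists k; rewrite setIT.
- by have [k h] := exists_shift_not_le Hirr sM (sA (leq0n N)); exists k; rewrite setIT.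
by rewrite /jump !setIT; exists k, j.
Qed.

(** Adding to M the first member of the chain not inside M gives a stable lattice strictly above M,
    hence one containing M+. So M+/M is the j-th factor. *)
Lemma label_jump M k (j : 'I_N) : meet_irreducible M ->
  k >> A j `<=` M -> ~ (k >> A j.+1 `<=` M) ->
  jump (k >> A j) (k >> A j.+1) (plus M) M /\
  plus M `<=` addm M ((k >> A j.+1) `&` plus M).
Proof.
move=> [sM sMp NMp] h1 h2.
have sA1 : slat (k >> A j.+1) by apply: slattice_shift => //; exact: sA.
have hM := slattice_submod sM; have hA1 := slattice_submod sA1.
have h3 : ~ ((k >> A j.+1) `&` plus M `<=` M).
  move=> h; apply: NMp => x Mpx.
  have : addm M (k >> A j.+1) x.
    apply: Mpx; first exact: (slattice_addm Hv Hc Hpi).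
      exact: (addmSl hA1).
    by move=> h'; apply: h2; apply: subset_trans h'; exact: (addmSr hM).
  move=> [m [a [Mm A1a xE]]].
  rewrite xE; apply: (submodD hM) => //; apply: h; split=> //.
  have -> : a = x - m by rewrite xE addrAC subrr add0r.
  by apply: (submodB Hv (slattice_submod sMp)) => //; exact: plus_ge.
split; first by split=> // u [/h1].
have sC := slattice_setI Hv Hc Hpi sA1 sMp.
apply: plus_le; first exact: (slattice_addm Hv Hc Hpi).
  exact: (addmSl (slattice_submod sC)).
by move=> h; apply: h3; apply: subset_trans h; exact: (addmSr hM).
Qed.

Lemma jump_shift l (B B' P Q : set V) : jump B B' P Q -> jump (l >> B) (l >> B') (l >> P) (l >> Q).
Proof.
move=> [h1 h2]; split; first by move=> u [? ?]; apply: h1.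
by move=> h; apply: h2; apply/(shift_subP l).
Qed.

(* Scale M' so that it lies in M but not in pi M; unless M' = M, both the kernel
   and the image of M'/pi M' -> M/pi M then contain the j-th factor. *)
Lemma label_inj M M' k k' (j : 'I_N) : meet_irreducible M -> meet_irreducible M' ->
  k >> A j `<=` M -> ~ (k >> A j.+1 `<=` M) ->
  k' >> A j `<=` M' -> ~ (k' >> A j.+1 `<=` M') -> exists l, M = l >> M'.
Proof.
move=> mM mM' a1 a2 a1' a2'.
have [|||l [lM lM1]] := @int_threshold (fun l => l >> M' `<=` M).
- move=> i i' ii' h u hu; apply: h; apply: (shift_le Hv Hpi _ ii' hu).
  by case: mM' => /slattice_submod.
- by apply: exists_shift_le; [case: mM|case: mM'].
- by apply: exists_shift_not_le => //; [case: mM|case: mM'].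
exists l; set M2 := l >> M' in lM *.
have mM2 : meet_irreducible M2 by exact: meet_irreducible_shift.
have b1 : (l + k') >> A j `<=` M2 by rewrite -(shiftD Hpi); exact: shiftS.
have b2 : ~ ((l + k') >> A j.+1 `<=` M2).
  by rewrite -(shiftD Hpi) => /shift_subP.
have NM2 : ~ M2 `<=` 1 >> M.
  move=> h; apply: lM1; move: h => /(@shiftS _ pi _ (-1)).
  by rewrite (shiftK Hpi) (shiftD Hpi) addrC.
move: (l + k') b1 b2 => e b1 b2; clearbody M2.
case: (mM) (mM2) => sM sMp NMp [sM2 sM2p NM2p].
have sPM : slat (1 >> M) by exact: slattice_shift.
(* The kernel of M2/pi M2 -> M/pi M is (M2 [&] pi M)/pi M2. If it is zero, then for u in M, pi^(n+1)
   u in M2 implies pi^n u in M2, and descent on n gives u in M2. *)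
have [caseA|caseB] := pselect (M2 `&` (1 >> M) `<=` 1 >> M2).
  apply/seteqP; split=> // u Mu.
  have [s sMM2] := exists_shift_le sM2 sM.
  have : M2 (pi ^ (`|s|%N)%:Z *: u).
    apply: sMM2; rewrite /shift /= (piX_scaleD Hpi).
    rewrite -[u](scale1r u) -(expr0z pi) in Mu.
    by apply: (submod_piX Hv Hpi (slattice_submod sM) _ Mu); lia.
  elim: (`|s|%N) => [|n IHn h]; first by rewrite expr0z scale1r.
  apply: IHn; have : (1 >> M2) (pi ^ n.+1%:Z *: u).
    apply: caseA; split=> //; rewrite /shift /= (piX_scaleD Hpi).
    rewrite -[u](scale1r u) -(expr0z pi) in Mu.
    by apply: (submod_piX Hv Hpi (slattice_submod sM) _ Mu); lia.
  rewrite /shift /= (piX_scaleD Hpi); congr (M2 (pi ^ _ *: u)); lia.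
exfalso.
(* P/Q is the copy of M+/M inside M/pi M, hence a j-th factor. *)
pose P := 1 >> plus M; pose Q := 1 >> M.
have sP : slat P by exact: slattice_shift.
have QP : Q `<=` P by apply: shiftS; exact: plus_ge.
have [jM plusM] := label_jump mM a1 a2.
have jPQ : jump ((1 + k) >> A j) ((1 + k) >> A j.+1) P Q.
  by rewrite -!(shiftD Hpi); exact: jump_shift.
have PQ : P `<=` addm Q (((1 + k) >> A j.+1) `&` P).
  move=> u /plusM[a [b [Ma [Ab Mb] uE]]].
  exists (pi ^ 1 *: a), (pi ^ 1 *: b); split.
  - by rewrite /Q /shift /= (piX_scaleNK Hpi).
  - by rewrite -(shiftD Hpi) /P /shift /= (piX_scaleNK Hpi).
  - by rewrite -scalerDr -uE (piX_scaleK Hpi).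
(* The kernel is nonzero, so pi^-1 M2 [&] M is strictly larger than M2 and contains M2+. *)
have P1Q : 1 >> plus M2 `<=` M2 `&` Q.
  have sB : slat (((-1) >> M2) `&` M) by apply: (slattice_setI Hv Hc Hpi) => //; exact: slattice_shift.
  have : plus M2 `<=` ((-1) >> M2) `&` M.
    apply: plus_le => //.
      move=> u M2u; split; last exact: lM.
      rewrite -(shift0 pi M2) in M2u.
      by apply: (shift_le Hv Hpi (slattice_submod sM2) _ M2u).
    move=> h; apply: caseB => u [M2u Mu]; apply: h; split=> //.
    by rewrite /shift /= opprK (piX_scaleK Hpi).
  by move=> h u /h[h1 h2]; split=> //; move: h1; rewrite /shift /= opprK (piX_scaleK Hpi).
have sP2 : slat (M2 `&` P) by exact: (slattice_setI Hv Hc Hpi).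
have P2P : M2 `&` P `<=` P by exact: subIsetr.
have Q2E : (M2 `&` P) `&` Q = M2 `&` Q by rewrite -setIA (setIidr QP).
(* The image is nonzero too: M2 + pi M is strictly larger than pi M, so it contains P. *)
have NP2 : ~ (M2 `&` P `<=` M2 `&` Q).
  move=> h; have [_ _] := meet_irreducible_shift 1 mM; apply.
  rewrite plus_shift => x Px.
  have hpM2 : addm M2 (1 >> M) x.
    move: Px; rewrite -/P /P -plus_shift; apply.
    - exact: (slattice_addm Hv Hc Hpi).
    - exact: (addmSr (slattice_submod sM2)).
    - by move=> h'; apply: NM2; apply: subset_trans h'; exact: (addmSl (slattice_submod sPM)).
  case: hpM2 => m [q [M2m Qq xE]]; rewrite xE.
  apply: (submodD (slattice_submod sPM)) => //; apply: (h m _).2; split=> //.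
  have -> : m = x - q by rewrite xE addrK.
  by apply: (submodB Hv (slattice_submod sP)) => //; exact: QP.
have sQ2 : slat (M2 `&` Q) by exact: (slattice_setI Hv Hc Hpi).
(* The step at which the chain enters (M2 [&] P)/(M2 [&] Q) must have type j, since this quotient
   embeds into P/Q. *)
have [||k2 [j2 J2]] := @jump_exists (M2 `&` P) (M2 `&` Q).
- have [s hs] := exists_shift_le sQ2 (sA (leq0n N)).
  by exists s => u [/hs].
- have [s hs] := exists_shift_le (sA (leq0n N)) sP2.
  exists (- s) => h; apply: NP2 => u P2u; apply: h; split=> //.
  by apply: hs; rewrite /shift /= opprK (piX_scaleNK Hpi).
have sA1 i (s : int) : slat (s >> A (i : 'I_N).+1) by apply: slattice_shift => //; exact: sA.
have fm i (s : int) := factor_map_shift s (Afac i).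
have jj : j2 = j.
  apply: Wiso; apply: (jump_isomorphic (Wirr j) (Wirr j2) (sA1 j _) (sA1 j2 _) sP sPM sP2
    QP P2P (fm j _) (fm j2 _) jPQ) => //.
  by rewrite -/Q Q2E; exact: J2.
subst j2.
have Q2P2 : M2 `&` Q `<=` M2 `&` P by apply: setIS.
have c1 := jump_cap (sA1 j _) (Wirr j) (fm j _) sP2 sQ2 Q2P2 J2.
have c2 := jump_sub Q2P2 J2.
have [jM2 _] := label_jump mM2 b1 b2.
have := jump_shift (k2 - e) jM2; rewrite !(shiftD Hpi) subrK => J3.
(* With s = k2 - e, one and the same step of the chain is visible in (M2 [&] P)/(M2 [&] Q) and in
   pi^s M2+/pi^s M2. If s <= 0, then M2 lies in pi^s M2; if s > 0, then pi^s M2+ lies in M2 [&] Q.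
   In both cases a numerator lies in the other denominator, where by [jump_cap] the step contributes
   nothing. *)
have [s0|s0] := leP (k2 - e) 0.
  apply: c2 => u [Au [M2u _]].
  apply: (jump_cap (sA1 j _) (Wirr j) (fm j _) _ _ _ J3); try exact: slattice_shift.
    by apply: shiftS; exact: plus_ge.
  split=> //; rewrite -(shift0 pi M2) in M2u.
  by apply: (shift_le Hv Hpi (slattice_submod sM2) s0 M2u).
have QP3 : (k2 - e) >> M2 `<=` (k2 - e) >> plus M2 by apply: shiftS; exact: plus_ge.
apply: (jump_sub QP3 J3) => u [Au pu]; apply: c1; split=> //.
apply: P1Q; apply: (shift_le Hv Hpi (slattice_submod sM2p) _ pu); lia.
Qed.

Lemma X_max_card_le : X_max v pi rho #<= `I_N.
Proof.
have /choice[f hf] : forall X : set (set V), exists j : nat, X_max v pi rho X ->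
    exists M k (j' : 'I_N), [/\ j = j', meet_irreducible M, X = homothety_class M,
      k >> A j' `<=` M & ~ (k >> A j'.+1 `<=` M)].
  move=> X; have [[M /(maximal_meet_irreducible Hirr) mM <-]|NX] := pselect (X_max v pi rho X).
    have [k [j [h1 h2]]] := label_exists (let: And3 h _ _ := mM in h).
    by exists j => _; exists M, k, j.
  by exists 0%N.
have finj : {in X_max v pi rho &, injective f}.
  move=> X Y; rewrite !inE => /hf[M [k [j [-> mM -> a1 a2]]]] /hf[M' [k' [j' [-> mM' -> b1 b2]]]].
  move=> /val_inj jj; subst j'.
  have [l ->] := label_inj mM mM' a1 a2 b1 b2.
  by apply: (homothety_class_shift Hv Hpi); case: mM' => /slattice_submod.
rewrite -(card_le_eql (inj_card_eq finj)); apply: subset_card_le.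
by move=> _ [X /hf[M [k [j [-> _ _ _ _]]]] <-] /=; exact: ltn_ord.
Qed.

End Maximal.


(** * The two bounds on the number of maximal classes *)

Section Counting.
Context (K : fieldType) (v : K -> int) (Hv : discrete_valuation v).
Context (Hc : val_complete v).
Context (pi : K) (Hpi : uniformiser v pi).
Context (V : vectType K) (G : groupType) (rho : G -> 'End(V)).
Context (Hirr : irreducible rho).

Lemma X_max_card_ge : (exists L, stable_lattice v rho L) ->
  `I_(X_dim v pi rho).+1 #<= X_max v pi rho.
Proof.
move=> /(X_dimP Hv Hc Hpi Hirr)[/(face_period Hv Hc Hpi Hirr)[A PA] _].
exact: (period_X_max Hv Hc Hpi Hirr PA).
Qed.

Context (F : fieldType) (red : K -> F) (Hred : residue_map v red).

Lemma reduction_period (L : set V) (E : vectType F) (tau : G -> 'End(E)) phi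
    (N : nat) (U : nat -> {vspace E}) :
  stable_lattice v rho L -> reduction v pi red rho L tau phi ->
  U 0%N = 0%VS -> U N = {:E}%VS ->
  (forall j, (j < N)%N -> (U j <= U j.+1)%VS) ->
  (forall j, (j < N)%N -> U j <> U j.+1) ->
  (forall j, (j <= N)%N -> stable_subspace tau (U j)) ->
  period v pi rho N (fun j => [set u | L u /\ phi u \in U j]).
Proof.
move=> /(slatticeP Hv Hc Hpi) sL [phiD phiZ phiS phi0 phiG] U0 UN Ule Une Ust.
have hL := slattice_submod sL.
have s1L : is_slattice v pi rho (shift pi 1 L) by exact: slattice_shift.
have s1LL : shift pi 1 L `<=` L.
  by rewrite -{2}(shift0 pi L); apply: (shift_le Hv Hpi).
have kerE u : shift pi 1 L u <-> L u /\ phi u = 0.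
  split=> [h|[Lu /phi0]]; last by rewrite -(shift1 Hpi); apply.
  have Lu := s1LL _ h; split=> //; apply/phi0 => //.
  by rewrite -(shift1 Hpi).
split.
- move=> j jN; split.
    apply: (lattice_sandwich (slattice_lat s1L) (slattice_lat sL)).
    + split.
      * have /kerE[h1 h2] : shift pi 1 L 0 by exact: submod0 (slattice_submod s1L).
        by split=> //; rewrite h2 mem0v.
      * move=> x y [Lx Ux] [Ly Uy]; split; first exact: submodD hL Lx Ly.
        by rewrite phiD // memvD.
      * move=> c x hc [Lx Ux]; split; first exact: submodZ hL hc Lx.
        by rewrite phiZ // memvZ.
    + by move=> u /kerE[Lu u0]; split=> //; rewrite u0 mem0v.
    + by move=> u [].
  move=> g u [Lu Uu]; split; first exact: sL.2.
  by rewrite phiG //; apply: (subvP (Ust j jN g)); exact: memv_img.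
- move=> j jN; split; first by move=> u [Lu Uu]; split=> //; exact: (subvP (Ule j jN)).
  move=> h; apply: (Une j jN); apply/eqP; rewrite eqEsubv Ule //=; apply/subvP => y Uy.
  have [x Lx xy] := phiS y; rewrite -xy.
  by apply: (h x _).2; split=> //; rewrite xy.
- apply/seteqP; split=> u /=.
    move=> [Lu]; rewrite U0 memv0 => /eqP u0.
    split; last by rewrite UN memvf.
    by have /kerE : L u /\ phi u = 0 by [].
  move=> [h _]; have /kerE[Lu u0] : shift pi 1 L u by [].
  by split=> //; rewrite u0 mem0v.
Qed.

(** A composition series of length N pulls back to a period, so there are at most N maximal classes;
    for N > 0 that period is a face of dimension N - 1, so N is at most 1 + dim. The lower bound
    closes the circle. *)
Lemma X_max_card_eq (r : nat) (W : 'I_r -> vectType F)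
    (sigma : forall i, G -> 'End(W i)) (m : 'I_r -> nat) :
  residual_semisimplification v pi red rho sigma m ->
  (forall i, m i = 1%N) -> X_max v pi rho #= `I_(X_dim v pi rho).+1.
Proof.
move=> [L [E [tau [phi [sL _ redphi ss]]]]] m1.
have ex : exists L, stable_lattice v rho L by exists L.
case: ss => srep sirr siso [N [U [kappa [[U0 UN] Ule Ust Usub card]]]].
pose f j := projT1 (cid (Usub j)).
have fP j : [/\ (f j @: U j.+1)%VS = {:W (kappa j)}%VS, (U j.+1 :&: lker (f j))%VS = U j
      & forall g x, x \in U j.+1 -> f j (tau g x) = sigma (kappa j) g (f j x)].
  by rewrite /f; case: cid.
have Une j : (j < N)%N -> U j <> U j.+1.
  move=> jN; have [im ker _] := fP (Ordinal jN).
  move=> Ue; rewrite /= in im ker; have [W0 _] := sirr (kappa (Ordinal jN)); apply: W0.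
  rewrite -im; apply/eqP; rewrite -subv0; apply/subvP => _ /memv_imgP[x Ux ->].
  rewrite memv0; move: Ux; rewrite -Ue -ker memv_cap => /andP[_].
  by rewrite memv_ker.
have Ule' j : (j < N)%N -> (U j <= U j.+1)%VS by move=> jN; exact: (Ule (Ordinal jN)).
have PA := reduction_period sL redphi U0 UN Ule' Une Ust.
(* Multiplicity one: each W_i is the type of a single step of the series. *)
have kinj i j : kappa i = kappa j -> i = j.
  move=> kij; have := card (kappa j); rewrite m1 => /eqP/card1P[i0 h].
  have := h i; have := h j; rewrite !inE kij !eqxx => /esym/eqP -> /esym/eqP ->.
  by [].
have le : X_max v pi rho #<= `I_N.
  apply: (X_max_card_le Hv Hc Hpi Hred Hirr PA
     (W := fun j => W (kappa j)) (sigma := fun j => sigma (kappa j))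
     (psi := fun j u => f j (phi u))).
  - by move=> j; exact: sirr.
  - move=> i j iso; apply: kinj; apply/eqP; apply: contrapT => /negP ne.
    exact: siso ne iso.
  - move=> j; case: redphi => phiD phiZ phiS phi0 phiG; have [im ker eq] := fP j.
    split.
    + by move=> x y [? ?] [? ?]; rewrite phiD // linearD.
    + by move=> c x hc [? ?]; rewrite phiZ // linearZ.
    + move=> w; have /memv_imgP[y Uy ->] : w \in (f j @: U j.+1)%VS by rewrite im memvf.
      by have [x Lx xy] := phiS y; exists x; rewrite ?xy //; split=> //; rewrite xy.
    + move=> x [Lx Ux]; rewrite /= -ker memv_cap Ux memv_ker.
      by split=> [->|[_ /= /eqP //]]; rewrite eqxx.
    + by move=> g x [Lx Ux]; rewrite phiG // eq.
have NX : (N <= (X_dim v pi rho).+1)%N.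
  case: N => // N' in U kappa U0 UN Ule Ust Usub card f fP Une Ule' PA kinj le *.
  rewrite ltnS; apply: (X_dimP Hv Hc Hpi Hirr ex).2.
  exact: (period_face Hv Hc Hpi PA).
apply/card_eqPle; split; last exact: X_max_card_ge.
by apply: card_le_trans le _; rewrite card_le_II.
Qed.

End Counting.


(** * Norms split by a basis, and the inequality of relative positions *)

Section Echelon.
Context (R : realType) (K : fieldType) (v : K -> int) (Hv : discrete_valuation v).

Lemma valu_prod (I : finType) (E : I -> K) : \prod_i E i != 0 ->
  v (\prod_i E i) = \sum_i v (E i).
Proof.
(* The guard is needed because [v 0] is arbitrary. *)
move=> h; pose P x (k : int) := x != 0 -> v x = k.
have : P (\prod_i E i) (\sum_i v (E i)); last exact.
apply: (big_ind2 P).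
- by move=> _; exact: (valu1 Hv).
- move=> x1 x2 y1 y2 h1 h2; rewrite /P mulf_eq0 negb_or => /andP[a b].
  by rewrite (valuM Hv) // h1 // h2.
- by [].
Qed.

(* Leibniz expansion of the determinant. *)
Lemma sum_le_val_det k (T : 'M[K]_k) (f g : 'I_k -> R) : \det T != 0 ->
  (forall i j, T i j != 0 -> f i <= (v (T i j))%:~R + g j) ->
  \sum_i f i <= (v (\det T))%:~R + \sum_j g j.
Proof.
move=> dT fg.
(* Some Leibniz term has valuation at most that of the determinant; otherwise the sum would have a
   larger valuation. *)
have [s s0 vs] : exists2 s : 'S_k, \prod_i T i (s i) != 0 & v (\prod_i T i (s i)) <= v (\det T).
  apply: contrapT => h.
  have : val_ge v (v (\det T) + 1) (\det T).
    rewrite {2}/determinant; apply: (val_ge_sum Hv) => s _.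
    have : val_ge v (v (\det T) + 1) (\prod_i T i (s i)).
      have [->|s0] := eqVneq (\prod_i T i (s i)) 0; first by left.
      right; apply: contrapT => /negP; rewrite -ltNge => lt.
      by apply: h; exists s => //; lia.
    by rewrite -signr_odd; case: (odd _) => //=; rewrite ?expr1 ?expr0 ?mul1r // mulN1r => /(val_geN Hv).
  by move=> [d0|]; [rewrite d0 eqxx in dT|lia].
have fs : \sum_i f i <= \sum_i ((v (T i (s i)))%:~R + g (s i)).
  apply: ler_sum => i _; apply: fg.
  by apply: contra_neq s0 => Ti0; rewrite (bigD1 i) //= Ti0 mul0r.
apply: le_trans fs _; rewrite big_split /= [\sum_j g j](reindex_inj (@perm_inj _ s)).
by rewrite lerD2r -(big_morph _ (intrD R) (mulr0z _)) -valu_prod // ler_int.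
Qed.

(** Cofactors along column i do not see that column, so they are those of the identity. *)
Lemma det_replace_col k (D : 'M[K]_k) i : (forall a j, j != i -> D a j = (a == j)%:R) ->
  \det D = D i i.
Proof.
move=> hD; rewrite (expand_det_col _ i).
have cof a : cofactor D a i = (\adj (1%:M : 'M[K]_k)) i a.
  rewrite mxE /cofactor; congr (_ * \det _); apply/matrixP => b c.
  by rewrite !mxE hD // eq_sym neq_lift.
under eq_bigr do rewrite cof adj1 mxE.
rewrite (bigD1 i) //= eqxx mulr1 big1 ?addr0 // => a ai.
by rewrite eq_sym (negPf ai) mulr0.
Qed.

(** The columns are given by a finite function, so that [echelon] can minimise over all minors. *)
Lemma row_free_minor k n (C : 'M[K]_(k, n)) : row_free C ->
  exists s : {ffun 'I_k -> 'I_n}, \det (colsub s C) != 0.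
Proof.
move=> frC; have fuC : row_full C^T by rewrite /row_full mxrank_tr.
exists [ffun i => fullrankfun fuC i].
have := row_full_unit (rowsub (fullrankfun fuC) C^T).
rewrite (fullrowsub_full fuC) => /esym; rewrite unitmxE unitfE -det_tr.
suff -> : (rowsub (fullrankfun fuC) C^T)^T = colsub [ffun i => fullrankfun fuC i] C by [].
by apply/matrixP => i j; rewrite !mxE ffunE.
Qed.

(* The chosen minor has the smallest weight; replacing one of its columns
   multiplies it by an entry of F, by Cramer's rule. *)
Lemma echelon k n (C : 'M[K]_(k, n)) (h : 'I_n -> R) : row_free C ->
  exists (T : 'M[K]_k) (s : 'I_k -> 'I_n), [/\ T \in unitmx,
    forall i j, (T *m C) i (s j) = (i == j)%:R &
    forall i m, (T *m C) i m != 0 -> h (s i) <= (v ((T *m C) i m))%:~R + h m].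
Proof.
move=> frC; have [s0 ds0] := row_free_minor frC.
pose obj (s : {ffun 'I_k -> 'I_n}) : R := (v (\det (colsub s C)))%:~R + \sum_i h (s i).
pose s := [arg min_(s < s0 | \det (colsub s C) != 0) obj s]%O.
have [ds smin] : \det (colsub s C) != 0 /\ forall t : {ffun 'I_k -> 'I_n}, \det (colsub t C) != 0 -> obj s <= obj t.
  by rewrite /s; case: arg_minP => // t ? ?.
have sU : colsub s C \in unitmx by rewrite unitmxE unitfE.
set T := invmx (colsub s C).
have Fs i j : (T *m C) i (s j) = (i == j)%:R.
  have -> : (T *m C) i (s j) = (T *m colsub s C) i j.
    by rewrite !mxE; apply: eq_bigr => l _; rewrite !mxE.
  by rewrite mulVmx // mxE.
exists T, s; split=> //; first by rewrite unitmx_inv.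
move=> i m Fim.
pose t := [ffun j => if j == i then m else s j].
have tE j : t j = if j == i then m else s j by rewrite ffunE.
have dt : \det (colsub t C) = \det (colsub s C) * (T *m C) i m.
  have -> : colsub t C = colsub s C *m colsub t (T *m C).
    rewrite -mulmx_colsub mulmxA mulmxV // mul1mx //.
  rewrite det_mulmx; congr (_ * _).
  rewrite (det_replace_col (i := i)); first by rewrite mxE tE eqxx.
  by move=> a j ji; rewrite mxE tE (negPf ji) Fs.
have := smin t; rewrite dt mulf_neq0 // => /(_ isT).
rewrite /obj dt (valuM Hv) // intrD -addrA lerD2l.
rewrite (bigD1 i) //= [X in _ <= _ + X](bigD1 i) //= tE eqxx addrA.
have -> : \sum_(j | j != i) h (t j) = \sum_(j | j != i) h (s j).
  by apply: eq_bigr => j /negPf ji; rewrite tE ji.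
by rewrite lerD2r.
Qed.

Context (V : vectType K).
Implicit Types (h : V -> R).

Definition frame n (e : 'I_n -> V) (x : 'I_n -> {scalar V}) :=
  (forall u, u = \sum_i x i u *: e i) /\ (forall i j, x i (e j) = (i == j)%:R).

(** h(u) is the minimum of v(x_i u) + h(e_i): an additive norm with e as splitting basis. The
    minimum runs over the nonzero coordinates, where [v] is meaningful. *)
Definition splits n h (e : 'I_n -> V) (x : 'I_n -> {scalar V}) :=
  forall u, u != 0 ->
    (forall i, x i u != 0 -> h u <= (v (x i u))%:~R + h (e i)) /\
    (exists2 i, x i u != 0 & h u = (v (x i u))%:~R + h (e i)).

Lemma frame_coord0 n (e : 'I_n -> V) x u : frame e x -> (forall i, x i u = 0) -> u = 0.
Proof. by move=> [h _] u0; rewrite (h u) big1 // => i _; rewrite u0 scale0r. Qed.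

Lemma scalar_neq0 (f : {scalar V}) u : f u != 0 -> u != 0.
Proof. by apply: contra_neq => ->; rewrite linear0. Qed.

Lemma splits_ultra n h (e : 'I_n -> V) x u w : splits h e x ->
  u != 0 -> w != 0 -> u + w != 0 -> Num.min (h u) (h w) <= h (u + w).
Proof.
move=> sp u0 w0 uw0; have [_ [i xi ->]] := sp _ uw0.
have [hu _] := sp _ u0; have [hw _] := sp _ w0.
rewrite linearD in xi *.
have [xu|xu] := eqVneq (x i u) 0.
  by rewrite xu add0r in xi *; rewrite ge_min hw ?orbT.
have [xw|xw] := eqVneq (x i w) 0.
  by rewrite xw addr0 in xi *; rewrite ge_min hu.
have : Num.min (v (x i u)) (v (x i w)) <= v (x i u + x i w).
  by case: Hv => _ h2 _; exact: h2.
rewrite ge_min => /orP[le|le]; rewrite ge_min; apply/orP; [left|right].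
  by apply: le_trans (hu i xu) _; rewrite lerD2r ler_int.
by apply: le_trans (hw i xw) _; rewrite lerD2r ler_int.
Qed.

(* Ky Fan's inequality for relative positions: the valuations of the determinants
   of the changes of basis cancel. *)
Lemma fan_triangle n k (b e e' : 'I_n -> V) xb xe xe' hx hy hz (t : 'I_k -> 'I_n) :
  frame b xb -> frame e xe -> frame e' xe' ->
  splits hy b xb -> splits hz b xb -> splits hy e xe -> splits hx e xe ->
  splits hx e' xe' -> splits hz e' xe' -> injective t ->
  exists s s' : 'I_k -> 'I_n, [/\ injective s, injective s' &
    \sum_i (hy (b (t i)) - hz (b (t i))) <=
    \sum_i (hy (e (s i)) - hx (e (s i))) + \sum_i (hx (e' (s' i)) - hz (e' (s' i)))].
Proof.
move=> fb fe fe' yb zb ye xxe xxe' ze' tinj.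
pose w i := b (t i).
have xbw i (c : 'I_k -> K) : xb (t i) (\sum_j c j *: w j) = c i.
  rewrite linear_sum (bigD1 i) //= linearZ /= fb.2 eqxx mulr1 big1 ?addr0 // => j ji.
  by rewrite linearZ /= fb.2 (inj_eq tinj) eq_sym (negPf ji) mulr0.
have free0 (c : 'I_k -> K) : \sum_j c j *: w j = 0 -> forall i, c i = 0.
  by move=> c0 i; rewrite -(xbw i c) c0 linear0.
have wn0 i : w i != 0.
  apply: (@scalar_neq0 (xb (t i))); rewrite fb.2 eqxx; exact: oner_neq0.
(* A basis of the span of the [w i] in echelon form for the frame f: the row y_i has pivot s(i),
   where the minimum defining its norm is attained. *)
have ech (f : 'I_n -> V) (xf : 'I_n -> {scalar V}) h : frame f xf -> splits h f xf ->
    exists (T : 'M[K]_k) (s : 'I_k -> 'I_n), let y i := \sum_l T i l *: w l in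
    [/\ T \in unitmx, injective s, forall i j, xf (s j) (y i) = (i == j)%:R,
      forall i, y i != 0 & forall i, h (f (s i)) <= h (y i)].
  move=> ff sp; pose C := \matrix_(i < k, m < n) xf m (w i).
  have xC (u : 'rV[K]_k) m : xf m (\sum_j u 0 j *: w j) = (u *m C) 0 m.
    rewrite linear_sum mxE; apply: eq_bigr => j _.
    by rewrite linearZ /= mxE.
  have frC : row_free C.
    apply: inj_row_free => u uC; apply/rowP => i; rewrite mxE.
    apply: (free0 (fun j => u 0 j)); apply: (frame_coord0 ff) => m.
    by rewrite xC uC mxE.
  have [T [s [TU Ts Tmin]]] := echelon (fun m => h (f m)) frC.
  have xT i m : xf m (\sum_l T i l *: w l) = (T *m C) i m.
    have := xC (row i T) m; rewrite -row_mul mxE => <-.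
    by congr (xf m _); apply: eq_bigr => l _; rewrite mxE.
  have xTs i j : xf (s j) (\sum_l T i l *: w l) = (i == j)%:R by rewrite xT.
  have yn0 i : \sum_l T i l *: w l != 0.
    apply: (@scalar_neq0 (xf (s i))); rewrite xTs eqxx; exact: oner_neq0.
  exists T, s; split=> //.
    move=> i j sij; apply/eqP; have := xTs i i; rewrite eqxx sij xTs => /eqP.
    by case: (i == j) => //; rewrite eq_sym oner_eq0.
  move=> i; have [_ [m xm ->]] := sp _ (yn0 i).
  by rewrite xT in xm *; exact: Tmin.
have [T [s [TU sinj Ts yn0 ymin]]] := ech e xe hx fe xxe.
have [T' [s' [TU' sinj' Ts' yn0' ymin']]] := ech e' xe' hz fe' ze'.
exists s, s'; split=> //.
have wE (S : 'M[K]_k) i : S \in unitmx ->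
    w i = \sum_j invmx S i j *: (\sum_l S j l *: w l).
  move=> SU; transitivity (\sum_l (invmx S *m S) i l *: w l).
    rewrite mulVmx // (bigD1 i) //= mxE eqxx scale1r big1 ?addr0 // => l li.
    by rewrite mxE eq_sym (negPf li) scale0r.
  under [RHS]eq_bigr do rewrite scaler_sumr.
  rewrite exchange_big /=; apply: eq_bigr => l _; rewrite mxE scaler_suml.
  by apply: eq_bigr => j _; rewrite scalerA.
have xw (f : 'I_n -> V) (xf : 'I_n -> {scalar V}) (S : 'M[K]_k) (s1 : 'I_k -> 'I_n) i j :
    S \in unitmx -> (forall i j, xf (s1 j) (\sum_l S i l *: w l) = (i == j)%:R) ->
    xf (s1 j) (w i) = invmx S i j.
  move=> SU hS; rewrite (wE S i SU) linear_sum (bigD1 j) //= linearZ /= hS eqxx mulr1.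
  by rewrite big1 ?addr0 // => l lj; rewrite linearZ /= hS (negPf lj) mulr0.
have dT : \det T != 0 by rewrite -unitfE -unitmxE.
have dT' : \det T' != 0 by rewrite -unitfE -unitmxE.
(* The path runs from w through the two echelon bases back to w. Odd steps expand a basis in the
   next frame and cost the valuation of a determinant; even steps replace frame vectors by echelon
   vectors. *)
have i1 : \sum_i hy (w i) <= (v (\det (invmx T)))%:~R + \sum_i hy (e (s i)).
  apply: sum_le_val_det; first by rewrite det_inv invr_eq0.
  move=> i j; rewrite -(xw e xe T s i j) // => ne.
  exact: (ye _ (wn0 i)).1.
have i2 : \sum_i hx (e (s i)) <= \sum_i hx (\sum_l T i l *: w l).
  by apply: ler_sum => i _; exact: ymin.
have i3 : \sum_i hx (\sum_l T i l *: w l) <=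
    (v (\det (T *m invmx T')))%:~R + \sum_i hx (e' (s' i)).
  apply: sum_le_val_det; first by rewrite det_mulmx mulf_neq0 // det_inv invr_eq0.
  move=> i j.
  have <- : xe' (s' j) (\sum_l T i l *: w l) = (T *m invmx T') i j.
    rewrite linear_sum mxE; apply: eq_bigr => l _.
    by rewrite linearZ /= (xw e' xe' T' s' l j).
  by move=> ne; exact: (xxe' _ (yn0 i)).1.
have i4 : \sum_i hz (e' (s' i)) <= \sum_i hz (\sum_l T' i l *: w l).
  by apply: ler_sum => i _; exact: ymin'.
have i5 : \sum_i hz (\sum_l T' i l *: w l) <= (v (\det T'))%:~R + \sum_i hz (w i).
  apply: sum_le_val_det => // i j; rewrite -(xbw j (fun l => T' i l)) => ne.
  exact: (zb _ (yn0' i)).1.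
have vdet : v (\det (T *m invmx T')) = v (\det T) - v (\det T').
  by rewrite det_mulmx (valuM Hv) ?det_inv ?invr_eq0 // (valuV Hv).
have vdet1 : v (\det (invmx T)) = - v (\det T) by rewrite det_inv (valuV Hv).
rewrite vdet intrB in i3; rewrite vdet1 intrN in i1.
rewrite !sumrB; lra.
Qed.

End Echelon.


(** * Sorted real vectors and the equality case of majorisation *)

Section RealVectors.
Context (R : realType).

Definition nonincr n (f : 'I_n -> R) := forall i j : 'I_n, (i <= j)%N -> f j <= f i.

Definition mean n (f : 'I_n -> R) := (\sum_i f i) / n%:R.

(** The Euclidean norm on R^n modulo constants, as in [euclidean_dist]. *)
Definition spread n (f : 'I_n -> R) := Num.sqrt (\sum_i (f i - mean f) ^+ 2).

Lemma sort_perm n (f : 'I_n -> R) : exists s : 'S_n, nonincr (f \o s).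
Proof.
pose r := [rel i j : 'I_n | f j <= f i].
have szs : size (sort r (enum 'I_n)) == n by rewrite size_sort size_enum_ord.
have /tuple_permP[s sE] : perm_eq (Tuple szs) (ord_tuple n).
  by rewrite /= perm_sort.
have sE' i : s i = nth i (sort r (enum 'I_n)) i.
  rewrite [sort _ _]sE.
  rewrite (nth_map i) ?size_enum_ord // nth_ord_enum tnth_ord_tuple.
  by [].
exists s => i j ij; rewrite /= !sE'.
have rtr : transitive r by move=> a b c /= h1 h2; exact: le_trans h2 h1.
have rtot : total r by move=> a b; exact: le_total.
have rr : reflexive r by move=> a /=; exact: lexx.
have -> : nth j (sort r (enum 'I_n)) j = nth i (sort r (enum 'I_n)) j.
  by apply: set_nth_default; rewrite size_sort size_enum_ord.
apply: (sorted_leq_nth rtr rr i (sort_sorted rtot (enum 'I_n)) i j) => //.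
  by rewrite inE size_sort size_enum_ord.
by rewrite inE size_sort size_enum_ord.
Qed.

(** Subtract the k-th largest value c. Any k entries of f - c sum to at most the sum of all its
    positive parts, and the first k entries reach that sum. *)
Lemma top_sum n (f : 'I_n -> R) k (kn : (k <= n)%N) (s : 'I_k -> 'I_n) : nonincr f -> injective s ->
  \sum_i f (s i) <= \sum_(i < k) f (widen_ord kn i).
Proof.
move=> fni sinj; case: k => [|k] in kn s sinj *; first by rewrite !big_ord0.
pose c := f (widen_ord kn ord_max).
have : \sum_i (f (s i) - c) <= \sum_(i < k.+1) (f (widen_ord kn i) - c); last first.
  by rewrite !sumrB lerD2r.
apply: (@le_trans _ _ (\sum_(i < n) Num.max (f i - c) 0)).
  apply: (@le_trans _ _ (\sum_i Num.max (f (s i) - c) 0)).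
    by apply: ler_sum => i _; rewrite le_max lexx.
  rewrite -(big_imset (fun i => Num.max (f i - c) 0) (h := s) (A := predT)) /=; last first.
    by move=> i j _ _; exact: sinj.
  rewrite [leRHS](bigID (fun i => i \in s @: predT)) /= lerDl.
  by apply: sumr_ge0 => i _; rewrite le_max lexx orbT.
rewrite (bigID (fun i : 'I_n => (i < k.+1)%N)) /= [X in _ + X]big1 ?addr0; last first.
  move=> i; rewrite -leqNgt => ki; apply/max_idPr; rewrite subr_le0.
  by apply: fni; exact: ltnW.
rewrite [leRHS](eq_bigr (fun i => Num.max (f (widen_ord kn i) - c) 0)); last first.
  move=> i _; apply/esym/max_idPl; rewrite subr_ge0; apply: fni => /=.
  by rewrite -ltnS.
by rewrite (big_ord_narrow kn).
Qed.

Lemma abel_sum n (f g : 'I_n -> R) : nonincr f ->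
  (forall k (kn : (k <= n)%N), 0 <= \sum_(i < k) g (widen_ord kn i)) ->
  \sum_i g i = 0 -> 0 <= \sum_i f i * g i.
Proof.
move=> fni gp g0.
(* Summation by parts in inductive form; at full length the left side vanishes because the g_i sum
   to 0. *)
have H k (kn : (k < n)%N) : f (Ordinal kn) * \sum_(i < k.+1) g (widen_ord kn i) <=
    \sum_(i < k.+1) f (widen_ord kn i) * g (widen_ord kn i).
  elim: k kn => [|k IHk] kn.
    rewrite !big_ord_recl !big_ord0 !addr0.
    by have -> : Ordinal kn = widen_ord kn ord0 by apply/val_inj.
  have kn' := ltnW kn.
  rewrite big_ord_recr [leRHS]big_ord_recr /= mulrDr.
  have -> : widen_ord kn ord_max = Ordinal kn by apply/val_inj.
  rewrite lerD2r.
  have e1 i : widen_ord kn (widen_ord (leqnSn k.+1) i) = widen_ord kn' i by apply/val_inj.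
  under eq_bigr do rewrite e1.
  under [leRHS]eq_bigr do rewrite e1.
  apply: le_trans (IHk kn').
  apply: ler_wpM2r; first exact: gp.
  by apply: fni => /=.
case: n => [|m] in f g fni gp g0 H *; first by rewrite big_ord0.
have := H m (ltnSn m).
have e i : widen_ord (ltnSn m) i = i by apply/val_inj.
under eq_bigr do rewrite e.
under [leRHS]eq_bigr do rewrite e.
by rewrite g0 mulr0.
Qed.

Lemma spread_ge0 n (f : 'I_n -> R) : 0 <= spread f.
Proof. exact: sqrtr_ge0. Qed.

Lemma spread_sqr n (f : 'I_n -> R) : spread f ^+ 2 = \sum_i (f i - mean f) ^+ 2.
Proof. by rewrite sqr_sqrtr // sumr_ge0 // => i _; exact: sqr_ge0. Qed.

Lemma spread0 n (f : 'I_n -> R) : spread f = 0 -> forall i j, f i = f j.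
Proof.
move=> sf0; have : \sum_i (f i - mean f) ^+ 2 = 0 by rewrite -spread_sqr sf0 expr0n.
move=> /eqP; rewrite psumr_eq0; last by move=> i _; exact: sqr_ge0.
move=> /allP h i j.
have {}h l : f l = mean f.
  by have := h l (mem_index_enum _); rewrite /= sqrf_eq0 subr_eq0 => /eqP.
by rewrite !h.
Qed.

Lemma spread_perm n (f : 'I_n -> R) (s : 'S_n) : spread (f \o s) = spread f.
Proof.
have me : mean (f \o s) = mean f.
  by rewrite /mean [in RHS](reindex_inj (@perm_inj _ s)).
by rewrite /spread me [in RHS](reindex_inj (@perm_inj _ s)).
Qed.

(** The sign is reversed because norms of basis vectors are a constant minus apartment
    coordinates. *)
Lemma eq_spread n (f g : 'I_n -> R) c : (forall i, f i = c - g i) -> spread f = spread g.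
Proof.
case: (posnP n) => [n0|n0] fg.
  by rewrite /spread !big1 // => i _; have := ltn_ord i; rewrite {2}n0.
have me : mean f = c - mean g.
  rewrite /mean (eq_bigr (fun i => c - g i)) // sumrB sumr_const card_ord mulrBl.
  by rewrite -[c *+ n]mulr_natr mulfK // pnatr_eq0 -lt0n.
congr Num.sqrt; apply: eq_bigr => i _; rewrite me fg; ring.
Qed.

Lemma sum_centred n (f : 'I_n -> R) : (0 < n)%N -> \sum_i (f i - mean f) = 0.
Proof.
move=> n0; rewrite sumrB sumr_const card_ord /mean -[_ *+ n]mulr_natr divfK ?subrr //.
by rewrite pnatr_eq0 -lt0n.
Qed.

(* If the partial sums of f are dominated by those of g + h, the equality case
   of Cauchy-Schwarz makes the three centred vectors proportional. *)
Lemma spread_additive_proportional n (f g h : 'I_n -> R) : (0 < n)%N -> nonincr f ->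
  (forall k (kn : (k <= n)%N), \sum_(i < k) f (widen_ord kn i) <=
     \sum_(i < k) g (widen_ord kn i) + \sum_(i < k) h (widen_ord kn i)) ->
  \sum_i f i = \sum_i g i + \sum_i h i -> spread f = spread g + spread h ->
  0 < spread g -> 0 < spread h ->
  (forall i, spread f * (g i - mean g) = spread g * (f i - mean f)) /\
  (forall i, spread f * (h i - mean h) = spread h * (f i - mean f)).
Proof.
move=> n0 fni part tot sp g0 h0.
have mE : mean f = mean g + mean h by rewrite /mean tot mulrDl.
pose l i := f i - mean f; pose m i := g i - mean g; pose p i := h i - mean h.
(* Abel summation against the sorted l gives |l|^2 <= l.m + l.p, while Cauchy-Schwarz bounds the
   right side by L (M + N) = L^2. So both scalar products are extremal. *)
have ab : 0 <= \sum_i l i * (m i + p i - l i).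
  apply: abel_sum.
  - by move=> i j ij; rewrite /l lerD2r fni.
  - move=> k kn; have := part k kn; rewrite -subr_ge0 => /le_trans; apply.
    rewrite -big_split /= -sumrB; apply: ler_sum => i _; rewrite /m /p /l mE; lra.
  - by rewrite sumrB big_split /= !sum_centred // subr0 addr0.
set L := spread f; set M := spread g; set N := spread h.
have L2 : \sum_i l i ^+ 2 = L ^+ 2 by rewrite spread_sqr.
have M2 : \sum_i m i ^+ 2 = M ^+ 2 by rewrite spread_sqr.
have N2 : \sum_i p i ^+ 2 = N ^+ 2 by rewrite spread_sqr.
(* Expanding |M l - L m|^2 proves Cauchy-Schwarz and yields proportionality when equality holds. *)
have sq (a b : R) (x y : 'I_n -> R) : \sum_i (a * x i - b * y i) ^+ 2 =
    a ^+ 2 * \sum_i x i ^+ 2 + b ^+ 2 * \sum_i y i ^+ 2 - 2 * a * b * \sum_i x i * y i.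
  rewrite !mulr_sumr -big_split /= -sumrB; apply: eq_bigr => i _; ring.
have ab' : L ^+ 2 <= \sum_i l i * m i + \sum_i l i * p i.
  rewrite -L2 -subr_ge0; apply: le_trans ab _.
  rewrite -big_split /= -sumrB; apply: ler_sum => i _; lra.
have LE : L = M + N by [].
have S1 := sq M L l m; have S2 := sq N L l p.
rewrite L2 M2 in S1; rewrite L2 N2 in S2.
have p1 : 0 <= \sum_i (M * l i - L * m i) ^+ 2 by apply: sumr_ge0 => i _; exact: sqr_ge0.
have p2 : 0 <= \sum_i (N * l i - L * p i) ^+ 2 by apply: sumr_ge0 => i _; exact: sqr_ge0.
set a := \sum_i l i * m i in S1 ab'; set b := \sum_i l i * p i in S2 ab'.
have M0 : 0 < M := g0; have N0 : 0 < N := h0.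
have L0 : 0 < L by rewrite LE addr_gt0.
have aLM : a <= L * M.
  rewrite S1 in p1.
  have e : M ^+ 2 * L ^+ 2 + L ^+ 2 * M ^+ 2 - 2 * M * L * a = (2 * M * L) * (L * M - a) by ring.
  by move: p1; rewrite e pmulr_rge0 ?subr_ge0 // !mulr_gt0.
have bLN : b <= L * N.
  rewrite S2 in p2.
  have e : N ^+ 2 * L ^+ 2 + L ^+ 2 * N ^+ 2 - 2 * N * L * b = (2 * N * L) * (L * N - b) by ring.
  by move: p2; rewrite e pmulr_rge0 ?subr_ge0 // !mulr_gt0.
have LL : L ^+ 2 = L * M + L * N by rewrite LE; ring.
have aE : a = L * M by lra.
have bE : b = L * N by lra.
have z1 : \sum_i (M * l i - L * m i) ^+ 2 = 0 by rewrite S1 aE; ring.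
have z2 : \sum_i (N * l i - L * p i) ^+ 2 = 0 by rewrite S2 bE; ring.
split=> i.
  move: z1 => /eqP; rewrite psumr_eq0; last by move=> j _; exact: sqr_ge0.
  by move=> /allP/(_ i (mem_index_enum _)); rewrite /= sqrf_eq0 subr_eq0 => /eqP.
move: z2 => /eqP; rewrite psumr_eq0; last by move=> j _; exact: sqr_ge0.
by move=> /allP/(_ i (mem_index_enum _)); rewrite /= sqrf_eq0 subr_eq0 => /eqP.
Qed.

End RealVectors.

(** * Three norms in geodesic position *)

Section Geodesic.
Context (R : realType) (K : fieldType) (v : K -> int) (Hv : discrete_valuation v).
Context (V : vectType K).

Lemma frame_perm n (e : 'I_n -> V) x (s : 'S_n) : frame e x ->
  frame (e \o s) (fun i => x (s i)).
Proof.
move=> [h1 h2]; split=> [u|i j]; last by rewrite /= h2 (inj_eq (@perm_inj _ s)).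
by rewrite {1}(h1 u) (reindex_inj (@perm_inj _ s)).
Qed.

Lemma splits_perm n (h : V -> R) (e : 'I_n -> V) x (s : 'S_n) : splits v h e x ->
  splits v h (e \o s) (fun i => x (s i)).
Proof.
move=> sp u u0; have [h1 [i xi h2]] := sp u u0; split=> [j|]; first exact: h1.
by exists ((s^-1)%g i); rewrite /= permKV.
Qed.

(** Compare at the coordinate where h' attains its minimum: there h is at most its own term. *)
Lemma splits_diff_le n (h h' : V -> R) (e : 'I_n -> V) x c : splits v h e x ->
  splits v h' e x -> (forall i, h (e i) - h' (e i) <= c) ->
  forall u, u != 0 -> h u - h' u <= c.
Proof.
move=> sp sp' he u u0; have [_ [i xi ->]] := sp' u u0.
have [h1 _] := sp u u0; have := h1 i xi; have := he i; lra.
Qed.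

(* On the span of the b i with hy - hz maximal, hy - hx is maximal and hz - hx is
   minimal. A dimension count shows that this span accounts for all vectors
   where hy - hx is maximal, up to vectors of larger hx. *)
Lemma sorted_geodesic_top n (b e e' : 'I_n -> V) xb xe xe' (hx hy hz : V -> R)
    (la mu nu : 'I_n -> R) (i0 : 'I_n) :
  frame b xb -> frame e xe ->
  splits v hy b xb -> splits v hz b xb -> splits v hy e xe -> splits v hx e xe ->
  splits v hx e' xe' -> splits v hz e' xe' ->
  (forall i, hy (b i) - hz (b i) = la i) ->
  (forall i, hy (e i) - hx (e i) = mu i) ->
  (forall i, hx (e' i) - hz (e' i) = nu i) ->
  (forall i, mu i <= mu i0) -> (forall i, nu i <= nu i0) ->
  la i0 = mu i0 + nu i0 -> (forall i, (mu i == mu i0) = (la i == la i0)) ->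
  forall u, u != 0 -> hy u - hx u = mu i0 -> hz u - hx u = - nu i0.
Proof.
move=> fb fe yb zb ye xxe xe'' ze' laE muE nuE muM nuM la0 top.
have yx : forall u, u != 0 -> hy u - hx u <= mu i0.
  by apply: (splits_diff_le ye xxe) => i; rewrite muE.
have xz : forall u, u != 0 -> hx u - hz u <= nu i0.
  by apply: (splits_diff_le xe'' ze') => i; rewrite nuE.
pose I := [pred i | la i == la i0].
have off w m : w != 0 -> hy w - hx w = mu i0 -> m \notin I -> xe m w != 0 ->
    hx w < (v (xe m w))%:~R + hx (e m).
  move=> w0 wtop mI xm; have [/(_ m xm) h1 _] := ye w w0.
  have lt : mu m < mu i0 by rewrite lt_neqAle muM andbT top.
  have := muE m; lra.
have onI w : w != 0 -> hy w - hx w = mu i0 ->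
    exists m, [/\ m \in I, xe m w != 0 & hx w = (v (xe m w))%:~R + hx (e m)].
  move=> w0 wtop; have [_ [m xm hE]] := xxe w w0.
  exists m; split=> //; apply: contrapT => /negP mI.
  by have := off w m w0 wtop mI xm; rewrite hE ltxx.
(* Here hy - hz is at least la i0 = mu i0 + nu i0, while hy - hx and hx - hz are at most mu i0 and
   nu i0, so both bounds are attained. *)
have Utop (c : 'I_n -> K) : (forall i, i \notin I -> c i = 0) ->
    let w := \sum_i c i *: b i in w != 0 -> hy w - hx w = mu i0 /\ hx w - hz w = nu i0.
  move=> cI w w0.
  have xbw i : xb i w = c i.
    rewrite linear_sum (bigD1 i) //= linearZ /= fb.2 eqxx mulr1 big1 ?addr0 // => j ji.
    by rewrite linearZ /= fb.2 eq_sym (negPf ji) mulr0.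
  have [y1 [i xi yE]] := yb w w0; have [z1 _] := zb w w0.
  have iI : i \in I.
    by apply: contraNT xi => /cI ci; rewrite xbw ci.
  have := z1 i xi; have := laE i; move: (iI); rewrite inE => /eqP ->.
  have := yx w w0; have := xz w w0; lra.
(* The block of e-coordinates of the b_i with indices in I, padded by the identity. It is
   invertible: a nonzero combination of these b_i is a top vector, and so has a nonzero coordinate
   in I. *)
pose D := \matrix_(i < n, j < n) if (i \in I) && (j \in I) then xe j (b i) else (i == j)%:R.
have cD (c : 'rV[K]_n) j : j \notin I -> (c *m D) 0 j = c 0 j.
  move=> jI; rewrite mxE (bigD1 j) //= mxE (negPf jI) andbF eqxx mulr1 big1 ?addr0 // => i ij.
  by rewrite mxE (negPf jI) andbF (negPf ij) mulr0.
have cDI (c : 'rV[K]_n) j : (forall i, i \notin I -> c 0 i = 0) -> j \in I ->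
    (c *m D) 0 j = xe j (\sum_i c 0 i *: b i).
  move=> cI jI; rewrite mxE linear_sum; apply: eq_bigr => i _; rewrite linearZ /= mxE jI andbT.
  by case: (boolP (i \in I)) => // /cI ->; rewrite !mul0r.
have DU : D \in unitmx.
  rewrite -row_free_unit; apply: inj_row_free => c c0.
  have cI i : i \notin I -> c 0 i = 0 by move=> iI; rewrite -(cD c i iI) c0 mxE.
  have [w0|w0] := eqVneq (\sum_i c 0 i *: b i) 0.
    apply/rowP => i; rewrite mxE.
    have := congr1 (xb i) w0; rewrite linear0 linear_sum (bigD1 i) //= linearZ /= fb.2 eqxx mulr1.
    rewrite big1 ?addr0 // => j ji.
    by rewrite linearZ /= fb.2 eq_sym (negPf ji) mulr0.
  have [wtop _] := Utop (fun i => c 0 i) cI w0.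
  have [m [mI xm _]] := onI _ w0 wtop.
  by move: xm; rewrite -cDI // c0 mxE eqxx.
move=> u u0 utop.
(* u' is the combination of the top b_i with the same I-coordinates as u. The difference u' - u has
   coordinates only off I, where hx is strictly larger, and cannot affect the comparison of hz. *)
pose r := \row_(j < n) if j \in I then xe j u else 0.
pose c := r *m invmx D.
have cDr : c *m D = r by rewrite /c mulmxKV.
have cI i : i \notin I -> c 0 i = 0 by move=> iI; rewrite -(cD c i iI) cDr mxE (negPf iI).
pose u' := \sum_i c 0 i *: b i.
have xeu' j : j \in I -> xe j u' = xe j u by move=> jI; rewrite -cDI // cDr mxE jI.
have [m [mI xm hxu]] := onI u u0 utop.
have u'0 : u' != 0 by apply: (@scalar_neq0 _ _ (xe m)); rewrite xeu'.
have [u'top u'z] := Utop (fun i => c 0 i) cI u'0; rewrite -/u' in u'top u'z.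
have hxu' : hx u' = hx u.
  have [m' [mI' xm' hxu'']] := onI u' u'0 u'top.
  apply/le_anti/andP; split.
    by rewrite hxu -xeu' //; apply: (xxe u' u'0).1; rewrite xeu'.
  by rewrite hxu'' xeu' //; apply: (xxe u u0).1; rewrite -xeu'.
have := xz u u0.
suff : hz u <= hz u' by lra.
have [uu'|uu'] := eqVneq u' u; first by rewrite uu'.
have d0 : u' - u != 0 by rewrite subr_eq0.
have hxd : hx u < hx (u' - u).
  have [_ [l xl ->]] := xxe _ d0.
  have lI : l \notin I.
    by apply: contra xl => lI; rewrite linearB /= xeu' // subrr.
  have h1 := off u l u0 utop lI; have h2 := off u' l u'0 u'top lI.
  rewrite hxu' in h2; rewrite linearB /= in xl *.
  have [a0|a0] := eqVneq (xe l u') 0.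
    rewrite a0 sub0r (valuN Hv); apply: h1.
    by rewrite a0 sub0r oppr_eq0 in xl.
  have [b0|b0] := eqVneq (xe l u) 0; first by rewrite b0 subr0 h2.
  have : Num.min (v (xe l u')) (v (- xe l u)) <= v (xe l u' - xe l u).
    by case: Hv => _ h _; apply: h => //; rewrite oppr_eq0.
  rewrite (valuN Hv) ge_min -!(ler_int R).
  by move=> /orP[le|le]; have := h1 b0; have := h2 a0; lra.
have lt : hz u' < hz (u' - u) by have := xz _ d0; lra.
have := splits_ultra Hv zb d0 u0; rewrite subrK => /(_ u'0).
by rewrite ge_min leNgt lt.
Qed.

(** Here a is the maximum of hy - hx, and d < c are the minimum and maximum of hz - hx. The
    inequality d < c reflects that x and z are distinct. *)
Lemma geodesic_top n (b e e' : 'I_n -> V) xb xe xe' (hx hy hz : V -> R) : (0 < n)%N ->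
  frame b xb -> frame e xe -> frame e' xe' ->
  splits v hy b xb -> splits v hz b xb -> splits v hy e xe -> splits v hx e xe ->
  splits v hx e' xe' -> splits v hz e' xe' ->
  spread (fun i => hy (b i) - hz (b i)) =
    spread (fun i => hy (e i) - hx (e i)) + spread (fun i => hx (e' i) - hz (e' i)) ->
  0 < spread (fun i => hy (e i) - hx (e i)) ->
  0 < spread (fun i => hx (e' i) - hz (e' i)) ->
  exists a c d : R, [/\
    (forall u, u != 0 -> hy u - hx u <= a) /\ (exists2 u, u != 0 & hy u - hx u = a),
    forall u, u != 0 -> hy u - hx u = a -> hz u - hx u = d,
    (forall u, u != 0 -> d <= hz u - hx u) /\ d < c &
    (forall u, u != 0 -> hz u - hx u <= c) /\ (exists2 u, u != 0 & hz u - hx u = c)].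
Proof.
move=> n0.
have [s1 ni1] := sort_perm (fun i => hy (b i) - hz (b i)).
have [s2 ni2] := sort_perm (fun i => hy (e i) - hx (e i)).
have [s3 ni3] := sort_perm (fun i => hx (e' i) - hz (e' i)).
move=> /(frame_perm s1) fb /(frame_perm s2) fe /(frame_perm s3) fe'.
move=> /(splits_perm s1) yb /(splits_perm s1) zb /(splits_perm s2) ye /(splits_perm s2) xxe.
move=> /(splits_perm s3) xxe' /(splits_perm s3) ze'.
rewrite -(spread_perm (fun i => hy (b i) - hz (b i)) s1).
rewrite -(spread_perm (fun i => hy (e i) - hx (e i)) s2).
rewrite -(spread_perm (fun i => hx (e' i) - hz (e' i)) s3).
set la := _ \o s1 in ni1 *; set mu := _ \o s2 in ni2 *; set nu := _ \o s3 in ni3 *.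
move=> sp sm sn.
have part k (kn : (k <= n)%N) : \sum_(i < k) la (widen_ord kn i) <=
     \sum_(i < k) mu (widen_ord kn i) + \sum_(i < k) nu (widen_ord kn i).
  have winj : injective (widen_ord kn) by move=> i j /(congr1 val) /= /val_inj.
  have [s [s' [si si' fan]]] := fan_triangle Hv fb fe fe' yb zb ye xxe xxe' ze' winj.
  apply: le_trans fan _; apply: lerD.
    exact: (top_sum kn ni2 si).
  exact: (top_sum kn ni3 si').
(* For k = n every injection is a permutation; applying the inequality again with y and z exchanged
   gives the reverse bound. *)
have tot : \sum_i la i = \sum_i mu i + \sum_i nu i.
  have idinj : injective (fun i : 'I_n => i) by [].
  apply/le_anti/andP; split.
    have [s [s' [si si' fan]]] := fan_triangle Hv fb fe fe' yb zb ye xxe xxe' ze' idinj.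
    apply: le_trans fan _.
    by rewrite [\sum_i mu i](reindex_inj si) [\sum_i nu i](reindex_inj si').
  have [s [s' [si si' fan]]] := fan_triangle Hv fb fe' fe zb yb ze' xxe' xxe ye idinj.
  rewrite -lerN2; apply: le_trans (le_trans _ fan) _.
    by rewrite -sumrN; apply: ler_sum => i _; rewrite opprB.
  rewrite [\sum_i mu i](reindex_inj si') [\sum_i nu i](reindex_inj si) opprD addrC -!sumrN.
  by apply: lerD; apply: ler_sum => i _; rewrite opprB.
have [pm pn] := spread_additive_proportional n0 ni1 part tot sp sm sn.
pose i0 : 'I_n := Ordinal n0.
have L0 : 0 < spread la by rewrite sp addr_gt0.
have muM i : mu i <= mu i0 by apply: ni2.
have nuM i : nu i <= nu i0 by apply: ni3.
have top i : (mu i == mu i0) = (la i == la i0).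
  have := pm i; have := pm i0; set L := spread la in L0 *; set M := spread mu in sm *.
  move=> h0 hi; have {}h0 : L * (mu i - mu i0) = M * (la i - la i0) by lra.
  rewrite -subr_eq0 -[RHS]subr_eq0.
  rewrite -[LHS](mulrI_eq0 _ (mulfI (lt0r_neq0 L0))) h0.
  by rewrite (mulrI_eq0 _ (mulfI (lt0r_neq0 sm))).
have la0 : la i0 = mu i0 + nu i0.
  have mE : mean la = mean mu + mean nu by rewrite /mean tot mulrDl.
  have := pm i0; have := pn i0; rewrite sp.
  set M := spread mu in sm *; set N := spread nu in sn *.
  move=> h1 h2.
  have MN : 0 < M + N by exact: addr_gt0.
  apply: (mulfI (lt0r_neq0 MN)); rewrite mE in h1 h2; lra.
have key := sorted_geodesic_top fb fe yb zb ye xxe xxe' ze'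
  (la := la) (mu := mu) (nu := nu) (i0 := i0) (fun=> erefl) (fun=> erefl) (fun=> erefl)
  muM nuM la0 top.
pose i1 : 'I_n := rev_ord i0.
have nul i : nu i1 <= nu i by apply: ni3; rewrite /= subn1 -ltnS prednK.
have en0 (f : 'I_n -> V) xf i : frame f xf -> f i != 0.
  by move=> ff; apply: (@scalar_neq0 _ _ (xf i)); rewrite ff.2 eqxx oner_neq0.
have zle : forall u, u != 0 -> hz u - hx u <= - nu i1.
  by apply: (splits_diff_le ze' xxe') => i; have := nul i; rewrite /nu /=; lra.
exists (mu i0), (- nu i1), (- nu i0); split.
- split; first exact: (splits_diff_le ye xxe).
  by exists ((e \o s2) i0); [exact: en0 fe|].
- exact: key.
- split.
    move=> u u0; have : hx u - hz u <= nu i0 by apply: (splits_diff_le xxe' ze' _ u0).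
    lra.
  rewrite ltrN2 lt_neqAle nul andbT; apply: contraPN sn => /eqP ne.
  have cst i : nu i = nu i0.
    by apply/le_anti/andP; split=> //; rewrite -ne nul.
  have me : mean nu = nu i0.
    rewrite /mean (eq_bigr (fun=> nu i0)) // sumr_const card_ord -[_ *+ n]mulr_natr mulfK //.
    by rewrite pnatr_eq0 -lt0n.
  rewrite /spread big1 ?sqrtr0 ?ltxx // => i _.
  by rewrite cst me subrr expr0n.
- split=> //; exists ((e' \o s3) i1); first exact: en0 fe'.
  by rewrite /nu /= opprB.
Qed.

End Geodesic.


(** * From points of the building to norms *)

Section Gauge.
Context (K : fieldType) (v : K -> int) (Hv : discrete_valuation v).
Context (Hc : val_complete v).
Context (pi : K) (Hpi : uniformiser v pi).
Context (V : vectType K).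
Implicit Types (L M : set V) (u w : V).

Local Notation is_lat := (is_lattice v pi).

(** The largest k with u in pi^k L. For u = 0 there is none, and the value is the default 0. *)
Definition gauge L u : int :=
  xget 0 [set k : int | forall l, L (pi ^ (- l) *: u) <-> l <= k].

Lemma gaugeP L u l : is_lat L -> u != 0 -> L (pi ^ (- l) *: u) <-> l <= gauge L u.
Proof.
move=> [hL Labs Lline] u0.
suff [k hk] : exists k : int, forall l, L (pi ^ (- l) *: u) <-> l <= k.
  have := @xgetI _ 0 [set k : int | forall l, L (pi ^ (- l) *: u) <-> l <= k] k hk.
  exact.
have [|||k [h1 h2]] := @int_threshold (fun k => L (pi ^ k *: u)).
- by move=> i j; exact: (submod_piX Hv Hpi hL).
- exact: Labs.
- apply: contrapT => h; move/eqP: u0; apply; apply: Lline => k.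
  by apply: contrapT => hk; apply: h; exists k.
exists (- k) => l'; split=> [h|lk]; last by apply: (submod_piX Hv Hpi hL _ h1); lia.
rewrite leNgt; apply/negP => lt; apply: h2.
by apply: (submod_piX Hv Hpi hL _ h); lia.
Qed.

Lemma gauge_unique L u k : is_lat L -> u != 0 ->
  (forall l, L (pi ^ (- l) *: u) <-> l <= k) -> gauge L u = k.
Proof.
move=> hL u0 h; apply/le_anti/andP; split.
  by apply/h; apply/gaugeP.
by apply/gaugeP => //; apply/h.
Qed.

Lemma gauge_mem L u : is_lat L -> u != 0 -> L u <-> 0 <= gauge L u.
Proof. by move=> hL u0; rewrite -gaugeP // oppr0 expr0z scale1r. Qed.

Lemma gauge_shift k L u : is_lat L -> u != 0 -> gauge (shift pi k L) u = gauge L u - k.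
Proof.
move=> hL u0; apply: gauge_unique => //; first exact: lattice_shift.
move=> l; rewrite /shift /= (piX_scaleD Hpi) -opprD gaugeP //.
by rewrite lerBrDl.
Qed.

Lemma gauge_le L L' u : is_lat L -> is_lat L' -> u != 0 -> L `<=` L' ->
  gauge L u <= gauge L' u.
Proof. by move=> hL hL' u0 LL'; apply/gaugeP => //; apply: LL'; apply/gaugeP. Qed.

Lemma lattice_gauge_eq L L' k : is_lat L -> is_lat L' ->
  (forall u, u != 0 -> gauge L' u = gauge L u - k) -> L' = shift pi k L.
Proof.
move=> hL hL' h; have hLk := lattice_shift Hpi k hL.
apply/seteqP; split=> u.
  have [-> _|u0] := eqVneq u 0; first exact: submod0 (lattice_submod hLk).
  by rewrite (gauge_mem hL' u0) (gauge_mem hLk u0) gauge_shift // h.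
have [-> _|u0] := eqVneq u 0; first exact: submod0 (lattice_submod hL').
by rewrite (gauge_mem hL' u0) (gauge_mem hLk u0) gauge_shift // h.
Qed.

Lemma gauge_apartment (b : (\dim {:V}).-tuple V) a u : free b -> u != 0 ->
  (forall i, coord b i u != 0 -> gauge (apartment_lattice v pi b a) u <= v (coord b i u) - a i) /\
  (exists2 i, coord b i u != 0 & gauge (apartment_lattice v pi b a) u = v (coord b i u) - a i).
Proof.
move=> frb u0.
have bb : basis_of {:V} b by rewrite -free_basis.
have [i0 ci0] : exists i, coord b i u != 0.
  apply: contrapT => h; move/eqP: u0; apply.
  rewrite (coord_basis bb (memvf u)) big1 // => i _.
  have [->|ci] := eqVneq (coord b i u) 0; first by rewrite scale0r.
  by case: h; exists i.
have latA : is_lat (apartment_lattice v pi b a).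
  apply/(latticeP Hv Hc Hpi).
  have sz : size [seq pi ^ a i *: tnth b i | i <- enum 'I_(\dim {:V})] == \dim {:V}.
    by rewrite size_map size_enum_ord.
  exists (Tuple sz).
    apply/freeP => c cE i.
    have : c i * pi ^ a i = 0.
      have /freeP frb' := frb; apply: (frb' (fun i => c i * pi ^ a i)).
      rewrite -[RHS]cE; apply: eq_bigr => j _.
      by rewrite (nth_map j) ?size_enum_ord // nth_ord_enum scalerA (tnth_nth 0).
    by move/eqP; rewrite mulf_eq0 (negPf (piX_neq0 Hpi _)) orbF => /eqP.
  congr integral_span; apply/funext => i.
  by rewrite [RHS](tnth_nth 0) /= (nth_map i) ?size_enum_ord // nth_ord_enum.
have mem l : apartment_lattice v pi b a (pi ^ (- l) *: u) <->
    forall i, coord b i u != 0 -> l <= v (coord b i u) - a i.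
  rewrite (apartment_latticeP Hv Hpi) //; split=> h i; have := h i; rewrite linearZ /=.
    move=> + ci => -[/eqP|].
      by rewrite mulf_eq0 (negPf ci) (negPf (piX_neq0 Hpi _)).
    by rewrite (valuM Hv) ?(piX_neq0 Hpi) // (val_piX Hv Hpi); lia.
  have [->|ci] := eqVneq (coord b i u) 0; first by rewrite mulr0; left.
  move=> /(_ isT) hi; right.
  by rewrite (valuM Hv) ?(piX_neq0 Hpi) // (val_piX Hv Hpi); lia.
have h1 i : coord b i u != 0 -> gauge (apartment_lattice v pi b a) u <= v (coord b i u) - a i.
  by move=> ci; apply: (mem _).1 ci; apply/gaugeP.
split=> //.
pose m := [arg min_(i < i0 | coord b i u != 0) (v (coord b i u) - a i)]%O.
have [cm mmin] : coord b m u != 0 /\ forall i, coord b i u != 0 ->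
    v (coord b m u) - a m <= v (coord b i u) - a i.
  by rewrite /m; case: arg_minP.
exists m => //; apply/le_anti/andP; split; first exact: h1.
by apply/gaugeP => //; apply/mem.
Qed.

(** Frees [face] from the special role of index 0, so that any two of its lattices compare
    symmetrically. *)
Lemma face_order n (x : 'I_n.+1 -> set (set V)) : face v pi x ->
  exists L : 'I_n.+1 -> set V,
    (forall i, is_lat (L i) /\ x i = homothety_class (L i)) /\
    forall i j, i != j ->
      (L i `<` L j /\ shift pi 1 (L j) `<` L i) \/ (L j `<` L i /\ shift pi 1 (L i) `<` L j).
Proof.
move=> [L [hL h0 hlt]]; exists L; split.
  by move=> i; have [/(latticeP Hv Hc Hpi) h1 h2] := hL i.
have key (i j : 'I_n.+1) : (i < j)%N ->
      (L i `<` L j /\ shift pi 1 (L j) `<` L i) \/ (L j `<` L i /\ shift pi 1 (L i) `<` L j).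
  move=> ij; have [i0|i0] := posnP i.
    have -> : i = ord0 by apply/val_inj.
    right; rewrite (shift1 Hpi); have [h1 h2] := h0 j (leq_ltn_trans (leq0n _) ij).
    by split.
  left; split; first exact: hlt.
  have [h1 _] := h0 i i0; have [_ [h2 _]] := h0 j (ltn_trans i0 ij).
  rewrite -(shift1 Hpi) in h1; case: h1 => h1 h3.
  have h4 : shift pi 1 (L j) `<=` shift pi 1 (L ord0) by exact: shiftS.
  by split; [exact: subset_trans h1|move=> h; apply: h3; exact: subset_trans h4].
move=> i j ij; have [lt|lt|e] := ltngtP i j; first exact: key.
  by have [] := key _ _ lt; [right|left].
by move: ij; rewrite (val_inj e) eqxx.
Qed.

Lemma face_inj n (x : 'I_n.+1 -> set (set V)) : face v pi x -> injective x.
Proof.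
move=> /face_order[L [hL hL2]] i j xij; apply: contrapT => /eqP ij.
wlog [lt1 lt2] : i j xij ij / L i `<` L j /\ shift pi 1 (L j) `<` L i.
  have [h|h] := hL2 i j ij; first by move=> /(_ i j xij ij h).
  by move=> /(_ j i (esym xij)); rewrite eq_sym => /(_ ij h).
have hLj := lattice_submod (hL j).1.
have [k Lk] : exists k, L i = shift pi k (L j).
  by apply: (homothety_class_eq Hv Hpi hLj); rewrite -(hL i).2 -(hL j).2.
have [k0|k0] := leP k 0.
  case: lt1 => _; apply; rewrite Lk -{1}(shift0 pi (L j)).
  exact: (shift_le Hv Hpi).
by case: lt2 => _; apply; rewrite Lk; apply: (shift_le Hv Hpi).
Qed.

Definition rep (X : set (set V)) : set V := xget set0 X.

Lemma rep_class L : submodule v L -> exists k, rep (homothety_class L) = shift pi k L.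
Proof.
move=> hL; apply/(homothety_classP Hv Hpi) => //.
exact: (xgetI set0 (homothety_class_id L)).
Qed.

(* The gauges of two lattices of a face differ by at most one, up to a constant:
   this keeps the face comonotone in every apartment containing it. *)
Lemma face_gauge n (x : 'I_n.+1 -> set (set V)) : face v pi x ->
  (forall i, is_lat (rep (x i)) /\ x i = homothety_class (rep (x i))) /\
  forall i j, exists k : int, forall u, u != 0 ->
    k <= gauge (rep (x i)) u - gauge (rep (x j)) u <= k + 1.
Proof.
move=> /face_order[L [hL hL2]].
have /choice[k_ hk] : forall i, exists k, rep (x i) = shift pi k (L i).
  by move=> i; rewrite (hL i).2; apply: rep_class; exact: lattice_submod (hL i).1.
split.
  move=> i; rewrite hk; split; first exact: lattice_shift (hL i).1.
  by rewrite (homothety_class_shift Hv Hpi) ?(hL i).2 //; exact: lattice_submod (hL i).1.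
have key i j : exists k : int, forall u, u != 0 -> k <= gauge (L i) u - gauge (L j) u <= k + 1.
  have [->|ij] := eqVneq i j.
    by exists 0 => u _; rewrite subrr.
  have le i' j' u : u != 0 -> L i' `<` L j' /\ shift pi 1 (L j') `<` L i' ->
      gauge (L i') u <= gauge (L j') u <= gauge (L i') u + 1.
    move=> u0 [[s1 _] [s2 _]]; apply/andP; split.
      by apply: gauge_le => //; exact: (hL _).1.
    rewrite -lerBlDr -gauge_shift //; last exact: (hL _).1.
    by apply: gauge_le => //; [exact: lattice_shift (hL _).1|exact: (hL _).1].
  have [h|h] := hL2 i j ij.
    by exists (-1) => u u0; have := le _ _ u u0 h; lia.
  by exists 0 => u u0; have := le _ _ u u0 h; lia.
move=> i j; have [k h] := key i j; exists (k - k_ i + k_ j) => u u0.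
rewrite !hk !gauge_shift //; try exact: (hL _).1.
by have := h u u0; lia.
Qed.

Context (R : realType).

(** On points of the realisation the sum is finite, as p is supported on a face. Another choice of
    representatives would add a constant, which [spread] ignores. *)
Definition pnorm (p : set (set V) -> R) u : R :=
  \sum_(X \in [set: set (set V)]) p X * (gauge (rep X) u)%:~R.

Lemma pnormE n (x : 'I_n.+1 -> set (set V)) p u : barycentric v pi x p ->
  pnorm p u = \sum_j p (x j) * (gauge (rep (x j)) u)%:~R.
Proof.
move=> [fx _ _ p0]; have xinj := face_inj fx.
rewrite /pnorm (fsbigE (codom x)) //=.
- rewrite big_map enumT; apply: eq_bigl => j; exact: in_setT.
- by rewrite map_inj_uniq ?enum_uniq.
- move=> X _ /negP NX; rewrite p0 ?mul0r // => -[j _ xj]; apply: NX.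
  by rewrite -xj codom_f.
Qed.

(** Each vertex gauge is a minimum over the coordinates in b. A barycentre of minima is again such a
    minimum because one coordinate is minimal for all vertices at once. *)
Lemma apartment_splits (b : (\dim {:V}).-tuple V) p c : free b ->
  apartment_coordinates v pi b p c ->
  splits v (pnorm p) (fun i => tnth b i) (fun i => coord b i : {scalar V}) /\
  exists C, forall i, pnorm p (tnth b i) = C - c i.
Proof.
move=> frb [n [x [a [bary xE cE]]]].
case: (bary) => fx p_ge0 p_sum _.
have [hL pair] := face_gauge fx.
have hA j : submodule v (apartment_lattice v pi b (a j)) by exact: submod_integral_span.
have /choice[k_ hk] : forall j, exists k, rep (x j) = shift pi k (apartment_lattice v pi b (a j)).
  by move=> j; rewrite xE; exact: rep_class.
have latA j : is_lat (apartment_lattice v pi b (a j)).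
  by rewrite -(shiftK Hpi (k_ j) (apartment_lattice _ _ _ _)) -hk; apply: lattice_shift => //; exact: (hL j).1.
have bn0 i : tnth b i != 0.
  by apply: (free_not0 frb); exact: mem_tnth.
have cb i j : coord b j (tnth b i) = (i == j)%:R by rewrite (tnth_nth 0) coord_free.
have gb i j : gauge (rep (x j)) (tnth b i) = - a j i - k_ j.
  rewrite hk gauge_shift //; have [_ [l cl ->]] := gauge_apartment (a j) frb (bn0 i).
  move: cl; rewrite cb; case: (i =P l) => [<- _|_]; last by rewrite eqxx.
  by rewrite (valu1 Hv) sub0r.
have nb i : pnorm p (tnth b i) = - (\sum_j p (x j) * (k_ j)%:~R) - c i.
  rewrite (pnormE _ bary) cE -!sumrN -big_split /=; apply: eq_bigr => j _.
  by rewrite gb intrB intrN; ring.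
split; last by exists (- (\sum_j p (x j) * (k_ j)%:~R)).
have gu j u i : u != 0 -> coord b i u != 0 ->
    gauge (rep (x j)) u <= v (coord b i u) + gauge (rep (x j)) (tnth b i).
  move=> u0 ci; rewrite gb hk gauge_shift //.
  have [/(_ i ci) h _] := gauge_apartment (a j) frb u0; lia.
have sumE (w : int) i : w%:~R + pnorm p (tnth b i) =
    \sum_j p (x j) * (w + gauge (rep (x j)) (tnth b i))%:~R.
  have -> : w%:~R = \sum_j p (x j) * w%:~R by rewrite -mulr_suml p_sum mul1r.
  rewrite (pnormE _ bary) -big_split /=.
  by apply: eq_bigr => j _; rewrite intrD mulrDr.
move=> u u0; split.
  move=> i ci; rewrite sumE (pnormE _ bary); apply: ler_sum => j _.
  by apply: ler_wpM2l => //; rewrite ler_int gu.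
have [i0 ci0] : exists i, coord b i u != 0.
  by have [_ [i ci _]] := gauge_apartment (a ord0) frb u0; exists i.
(* A minimiser m of the total over the face minimises every term: if l beats m for one vertex, it
   does so by at least 1, and since the gauges of two vertices differ by a quantity varying by at
   most 1, l is no worse for any other vertex. *)
pose obj i : int := \sum_j (v (coord b i u) + gauge (rep (x j)) (tnth b i)).
pose m := [arg min_(i < i0 | coord b i u != 0) obj i]%O.
have [cm mmin] : coord b m u != 0 /\ forall i, coord b i u != 0 -> obj m <= obj i.
  by rewrite /m; case: arg_minP.
exists m => //; rewrite sumE (pnormE _ bary); apply: eq_bigr => j _.
congr (_ * _%:~R); apply/le_anti/andP; split; first exact: gu.
have [_ [l cl gE]] := gauge_apartment (a j) frb u0.
have {}gE : gauge (rep (x j)) u = v (coord b l u) + gauge (rep (x j)) (tnth b l).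
  by rewrite gb hk gauge_shift // gE; lia.
rewrite gE leNgt; apply/negP => lt.
have := mmin l cl; rewrite leNgt => /negP; apply.
rewrite /obj (bigD1 j) //= [ltRHS](bigD1 j) //=; apply: ltr_leD => //.
apply: ler_sum => j' _; have [k hk'] := pair j j'.
have aux (a1 a2 b1 b2 c1 c2 k0 : int) : a1 + b1 < a2 + b2 -> k0 <= b1 - c1 <= k0 + 1 ->
  k0 <= b2 - c2 <= k0 + 1 -> a1 + c1 <= a2 + c2 by lia.
exact: aux lt (hk' _ (bn0 l)) (hk' _ (bn0 m)).
Qed.

Lemma basis_frame (b : (\dim {:V}).-tuple V) : free b ->
  frame (fun i => tnth b i) (fun i => coord b i : {scalar V}).
Proof.
move=> frb; have bb : basis_of {:V} b by rewrite -free_basis.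
split=> [u|i j]; last by rewrite /= (tnth_nth 0) coord_free // eq_sym.
rewrite {1}(coord_basis bb (memvf u)); apply: eq_bigr => i _.
by rewrite (tnth_nth 0).
Qed.

Lemma building_dist_spread (p q : set (set V) -> R) d : building_dist v pi p q d ->
  exists (e : 'I_(\dim {:V}) -> V) x, [/\ frame e x, splits v (pnorm p) e x,
    splits v (pnorm q) e x & d = spread (fun i => pnorm p (e i) - pnorm q (e i))].
Proof.
move=> [b [c [c' [bb ac ac' ->]]]].
have frb : free b by rewrite free_basis.
have [sp [C hC]] := apartment_splits frb ac.
have [sp' [C' hC']] := apartment_splits frb ac'.
exists (fun i => tnth b i), (fun i => coord b i : {scalar V}); split=> //.
  exact: basis_frame.
rewrite -[LHS]/(spread (fun i => c i - c' i)).
by apply: (eq_spread (c := C - C')) => i; rewrite hC hC'; ring.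
Qed.

(** If p charges x_j, the difference between the gauges of M and of x_j is confined to an interval
    of length 1 - p(x_j) < 1. Being an integer it is constant, so x_j is the class of M. *)
Lemma realisation_vertex n (x : 'I_n.+1 -> set (set V)) (p : set (set V) -> R) M C :
  barycentric v pi x p -> is_lat M ->
  (forall u, u != 0 -> pnorm p u - (gauge M u)%:~R = C) ->
  p = vertex_point R (homothety_class M).
Proof.
move=> bary hM hC; case: (bary) => fx p_ge0 p_sum p0.
have [hL pair] := face_gauge fx; have xinj := face_inj fx.
have supp j : p (x j) != 0 -> x j = homothety_class M.
  move=> pj; have pj0 : 0 < p (x j) by rewrite lt_neqAle eq_sym pj p_ge0.
  have /choice[k hk] := fun i => pair i j.
  pose S := \sum_(i | i != j) p (x i) * (k i)%:~R.
  have sum1 : \sum_(i | i != j) p (x i) = 1 - p (x j).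
    by rewrite -p_sum [in RHS](bigD1 j) //= addrAC subrr add0r.
  have bnd u : u != 0 -> S <= pnorm p u - (gauge (rep (x j)) u)%:~R <= S + (1 - p (x j)).
    move=> u0.
    have -> : pnorm p u - (gauge (rep (x j)) u)%:~R =
        \sum_(i | i != j) p (x i) * (gauge (rep (x i)) u - gauge (rep (x j)) u)%:~R.
      have {1}-> : (gauge (rep (x j)) u)%:~R = \sum_i p (x i) * (gauge (rep (x j)) u)%:~R.
        by rewrite -mulr_suml p_sum mul1r.
      rewrite (pnormE _ bary) -sumrB.
      rewrite (bigD1 j) //= subrr add0r; apply: eq_bigr => i _.
      by rewrite intrB mulrBr.
    apply/andP; split.
      apply: ler_sum => i _; apply: ler_wpM2l => //; rewrite ler_int.
      by have /andP[] := hk i u u0.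
    rewrite -sum1 -big_split /=; apply: ler_sum => i _.
    rewrite -[X in _ <= _ + X]mulr1 -mulrDr; apply: ler_wpM2l => //.
    by rewrite -intrD1 ler_int; have /andP[] := hk i u u0.
  have cst u u' : u != 0 -> u' != 0 ->
      gauge M u - gauge (rep (x j)) u <= gauge M u' - gauge (rep (x j)) u'.
    move=> u0 u0'; rewrite -ltzD1 -(ltr_int R) !intrD !intrN.
    have := bnd u u0; have := bnd u' u0'; have := hC u u0; have := hC u' u0'.
    move=> h1 h2 /andP[h3 h4] /andP[h5 h6]; lra.
  have [k' hk'] : exists k', forall u, u != 0 -> gauge (rep (x j)) u = gauge M u - k'.
    have [[u0 u0n]|none] := pselect (exists u : V, u != 0); last first.
      by exists 0 => u u0; case: none; exists u.
    exists (gauge M u0 - gauge (rep (x j)) u0) => u un.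
    by have := cst u u0 un u0n; have := cst u0 u u0n un; lia.
  rewrite (hL j).2 (lattice_gauge_eq hM (hL j).1 hk').
  exact: (homothety_class_shift Hv Hpi _ (lattice_submod hM)).
have [j0 pj0] : exists j, p (x j) != 0.
  apply: contrapT => h; have := p_sum; rewrite big1; first by move/eqP; rewrite eq_sym oner_eq0.
  move=> j _; apply/eqP; apply: contrapT => /negP pj; apply: h; by exists j.
apply/funext => Y; rewrite /vertex_point; case: asboolP => [->|YM].
  rewrite -p_sum (bigD1 j0) //= (supp j0 pj0) big1 ?addr0 // => j jj0.
  apply/eqP; apply: contraNT jj0 => pj; apply/eqP/xinj.
  by rewrite (supp j pj) (supp j0 pj0).
have [[j _ xj]|/p0 //] := pselect (range x Y).
rewrite -xj; apply/eqP; apply: contrapT => /negP pj.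
by apply: YM; rewrite -xj (supp j pj).
Qed.

End Gauge.


(** * Extremality of the classes of maximal lattices *)

Section Extremal.
Context (R : realType) (K : fieldType) (v : K -> int) (Hv : discrete_valuation v).
Context (Hc : val_complete v).
Context (pi : K) (Hpi : uniformiser v pi).
Context (V : vectType K).

Local Notation is_lat := (is_lattice v pi).
Local Notation pnorm := (pnorm pi).
Local Notation gauge := (gauge pi).

Lemma splits_scale n (h : V -> R) (e : 'I_n -> V) x c u : splits v h e x ->
  c != 0 -> u != 0 -> h (c *: u) = (v c)%:~R + h u.
Proof.
move=> sp c0 u0; have cu0 : c *: u != 0 by rewrite scaler_eq0 negb_or c0.
have [h1 [i xi hE]] := sp u u0; have [h1' [i' xi' hE']] := sp _ cu0.
apply/le_anti/andP; split.
  have := h1' i; rewrite linearZ /= mulf_neq0 // => /(_ isT).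
  by rewrite (valuM Hv) // intrD hE addrA.
move: xi' hE'; rewrite linearZ /= mulf_eq0 negb_or => /andP[_ xi'] ->.
by rewrite (valuM Hv) // intrD -addrA lerD2l; exact: h1.
Qed.

Context (G : groupType) (rho : G -> 'End(V)).
Local Notation slat := (is_slattice v pi rho).

Lemma gauge_stable L g u : slat L -> u != 0 -> rho g u != 0 ->
  gauge L u <= gauge L (rho g u).
Proof.
move=> [hL sL] u0 gu0; apply/(gaugeP Hv Hpi _ hL gu0).
by rewrite -linearZ; apply: sL; apply/(gaugeP Hv Hpi).
Qed.

Lemma pnorm_stable (p : set (set V) -> R) g u : X_realisation v pi rho p ->
  u != 0 -> rho g u != 0 -> pnorm p u <= pnorm p (rho g u).
Proof.
move=> [[n [x bary]] pX] u0 gu0; rewrite !(pnormE Hv Hc Hpi _ bary).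
case: (bary) => fx p_ge0 _ _; have [hL _] := face_gauge Hv Hc Hpi fx.
apply: ler_sum => j _; have [->|pj] := eqVneq (p (x j)) 0; first by rewrite !mul0r.
apply: ler_wpM2l => //; rewrite ler_int; apply: gauge_stable => //.
by apply/(X_verticesP Hv Hc Hpi); rewrite -(hL j).2; exact: pX.
Qed.

Lemma face0 (L : set V) : lattice v L -> face v pi (fun _ : 'I_1 => homothety_class L).
Proof. by move=> hL; exists (fun=> L); split=> [i|i|i j]; rewrite ?(ord1 i). Qed.

Lemma vertex_barycentric (L : set V) : lattice v L ->
  barycentric v pi (fun _ : 'I_1 => homothety_class L)
    (vertex_point R (homothety_class L)).
Proof.
move=> hL; split; first exact: face0.
- by move=> i; rewrite /vertex_point; case: ifP.
- by rewrite big_ord1 /vertex_point asboolT.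
- move=> Y NY; rewrite /vertex_point asboolF // => YL; apply: NY.
  by exists ord0.
Qed.

(* The unit ball of h in M, scaled by pi^-1, together with M is a stable lattice
   strictly above M, so it contains plus M. *)
Lemma plus_ball M (h : V -> R) a : slat M ->
  (forall c u, c != 0 -> u != 0 -> h (c *: u) = (v c)%:~R + h u) ->
  (forall u w, u != 0 -> w != 0 -> u + w != 0 -> Num.min (h u) (h w) <= h (u + w)) ->
  (forall g u, u != 0 -> rho g u != 0 -> h u <= h (rho g u)) ->
  (exists2 u, u != 0 & h u - (gauge M u)%:~R = a) ->
  forall q, plus v pi rho M q -> ~ M q ->
  exists s m, [/\ M s /\ M m, s != 0, a <= h s & q = pi ^ (-1) *: s + m].
Proof.
move=> sM hZ hD hG [u0 u0n hu0] q pq NMq.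
have hM := slattice_submod sM; have lM := slattice_lat sM.
pose S := [set u | M u /\ (u = 0 \/ a <= h u)].
have hS : submodule v S.
  split.
  - by split; [exact: submod0 hM|left].
  - move=> u w [Mu hu] [Mw hw]; split; first exact: submodD hM Mu Mw.
    have [u0'|u0'] := eqVneq u 0; first by rewrite u0' add0r.
    have [w0'|w0'] := eqVneq w 0; first by rewrite w0' addr0.
    have [uw0|uw0] := eqVneq (u + w) 0; first by left.
    case: hu => [/eqP|hu]; first by rewrite (negPf u0').
    case: hw => [/eqP|hw]; first by rewrite (negPf w0').
    by right; apply: le_trans (hD _ _ u0' w0' uw0); rewrite le_min hu.
  - move=> c u hc [Mu hu]; split; first exact: submodZ hM hc Mu.
    have [c0|c0] := eqVneq c 0; first by left; rewrite c0 scale0r.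
    have [u0'|u0'] := eqVneq u 0; first by left; rewrite u0' scaler0.
    case: hu => [/eqP|hu]; first by rewrite (negPf u0').
    right; rewrite hZ //; case: hc => [/eqP|hc]; first by rewrite (negPf c0).
    by apply: le_trans hu _; rewrite lerDr ler0z.
have sS : gstable rho S.
  move=> g u [Mu hu]; split; first exact: sM.2.
  have [gu0|gu0] := eqVneq (rho g u) 0; first by left.
  have u0' : u != 0 by apply: contra_neq gu0 => ->; rewrite linear0.
  case: hu => [/eqP|hu]; first by rewrite (negPf u0').
  by right; apply: le_trans hu (hG _ _ u0' gu0).
pose B := addm (shift pi (-1) S) M.
have sB : slat B.
  split.
    apply: (lattice_sandwich lM (lattice_shift Hpi (-1) lM)).
    - by apply: submod_addm => //; exact: submod_shift.
    - by apply: (addmSr (v := v)); exact: submod_shift.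
    - apply: (addm_sub (submod_shift pi (-1) hM)); first by move=> u [].
      by rewrite -{1}(shift0 pi M); apply: (shift_le Hv Hpi).
  move=> g _ [x [m [Sx Mm ->]]]; exists (rho g x), (rho g m); split.
  - by rewrite /shift /= -linearZ; exact: sS.
  - exact: sM.2.
  - by rewrite linearD.
have MB : M `<=` B by apply: (addmSr (v := v)); exact: submod_shift.
have NBM : ~ B `<=` M.
  (* Scaling u0 to gauge 0 gives w in M with h(w) = a, so pi^-1 w lies in B but not in M. *)
  move=> BM; pose k := gauge M u0; pose w := pi ^ (- k) *: u0.
  have Sw : S w.
    split; first by apply/(gaugeP Hv Hpi).
    right; rewrite /w hZ ?(piX_neq0 Hpi) // (val_piX Hv Hpi) -hu0 intrN addrC.
    by rewrite lexx.
  have : M (pi ^ (-1) *: w).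
    apply: BM; exists (pi ^ (-1) *: w), 0; split; last by rewrite addr0.
      by rewrite /shift /= (piX_scaleNK Hpi).
    exact: submod0 hM.
  rewrite /w (piX_scaleD Hpi) -opprD => /(gaugeP Hv Hpi _ lM u0n).
  rewrite -/k; lia.
have [x [m [Sx Mm qE]]] := pq B sB MB NBM.
exists (pi ^ 1 *: x), m; case: Sx; rewrite opprK => Mx hx.
have x0 : pi ^ 1 *: x != 0.
  apply/eqP => x0; apply: NMq; rewrite qE -(piX_scaleNK Hpi 1 x) x0 scaler0 add0r.
  exact: Mm.
split=> //; last by rewrite (piX_scaleNK Hpi).
by case: hx => // /eqP; rewrite (negPf x0).
Qed.

Lemma X_max_extremal (Hirr : irreducible rho) :
  X_max v pi rho `<=` extremal_vertices R v pi rho.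
Proof.
move=> _ [M0 maxM0 <-].
have mM0 := maximal_meet_irreducible Hv Hc Hpi Hirr maxM0.
have sM0 : slat M0 by case: mM0.
set X := homothety_class M0.
have XV : X_vertices v rho X by apply/(X_verticesP Hv Hc Hpi).
(* With the representative chosen by [rep], the norm of the vertex is exactly the gauge of M. *)
have [k repX] := rep_class Hv Hpi (slattice_submod sM0).
rewrite -/X in repX; set M := rep X in repX.
have mM : meet_irreducible v pi rho M by rewrite repX; exact: (meet_irreducible_shift Hpi).
have [sM spM NpM] := mM.
have lM := slattice_lat sM; have hM := lattice_submod lM.
have XE : homothety_class M = X.
  by rewrite repX (homothety_class_shift Hv Hpi) //; exact: slattice_submod sM0.
have latM0 : lattice v M0 by apply/(latticeP Hv Hc Hpi); exact: slattice_lat sM0.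
have baryX := vertex_barycentric latM0; rewrite -/X in baryX.
have hxE u : pnorm (vertex_point R X) u = (gauge M u)%:~R.
  by rewrite (pnormE Hv Hc Hpi _ baryX) big_ord1 /vertex_point asboolT // mul1r.
split=> //; split.
  split; first by exists 0%N, (fun=> X).
  by move=> Y; rewrite /vertex_point; case: asboolP => [-> //|]; rewrite eqxx.
move=> y z Xy Xz [l [gamma [l0 g0 gl dist [t /andP[t0 tl] xE]]]].
have n0 : (0 < \dim {:V})%N.
  by rewrite lt0n dimv_eq0; apply/eqP; case: Hirr.
have dxy : building_dist v pi y (vertex_point R X) t.
  have := dist 0 t; rewrite g0 -xE sub0r normrN ger0_norm //; apply.
    by rewrite lexx.
  by rewrite t0.
have dxz : building_dist v pi (vertex_point R X) z (l - t).
  have := dist t l; rewrite gl -xE distrC ger0_norm ?subr_ge0 //; apply.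
    by rewrite t0.
  by rewrite l0 lexx.
have dyz : building_dist v pi y z l.
  have := dist 0 l; rewrite g0 gl sub0r normrN ger0_norm //; apply.
    by rewrite lexx.
  by rewrite l0 lexx.
have [b [xb [fb yb zb lE]]] := building_dist_spread Hv Hc Hpi dyz.
have [e [xe [fe ye xxe tE]]] := building_dist_spread Hv Hc Hpi dxy.
have [e' [xe' [fe' xxe' ze' ltE]]] := building_dist_spread Hv Hc Hpi dxz.
set hy := pnorm y in yb ye lE tE *; set hz := pnorm z in zb ze' lE ltE *.
set hx := pnorm (vertex_point R X) in xxe xxe' tE ltE *.
(* A point whose norm differs from hx by a constant on a common frame is the vertex itself; this
   settles the case where one of the two distances is zero. *)
have vertex p h' n (f : 'I_n -> V) xf : X_realisation v pi rho p -> h' = pnorm p ->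
    splits v h' f xf -> splits v hx f xf -> frame f xf ->
    (forall i j, h' (f i) - hx (f i) = h' (f j) - hx (f j)) ->
    (0 < n)%N -> vertex_point R X = p.
  move=> [[m [xx bary]] _] -> sp spx ff cst n0'.
  have i0 : 'I_n := Ordinal n0'.
  rewrite -XE; apply/esym.
  apply: (realisation_vertex Hv Hc Hpi (C := pnorm p (f i0) - hx (f i0)) bary lM) => u u0.
  rewrite -hxE -/hx; apply/le_anti/andP; split.
    by apply: (splits_diff_le sp spx _ u0) => i; rewrite (cst i i0).
  have : hx u - pnorm p u <= - (pnorm p (f i0) - hx (f i0)).
    by apply: (splits_diff_le spx sp _ u0) => i; rewrite -(cst i i0) opprB.
  lra.
have [sy|sy] := eqVneq (spread (fun i => hy (e i) - hx (e i))) 0.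
  left; apply: (vertex _ _ _ _ _ Xy erefl ye xxe fe) => // i j.
  exact: (spread0 sy i j).
have [sz|sz] := eqVneq (spread (fun i => hx (e' i) - hz (e' i))) 0.
  right; apply: (vertex _ _ _ _ _ Xz erefl ze' xxe' fe') => // i j.
  by have /= := spread0 sz i j; rewrite /hz /hx; lra.
exfalso.
have [|||a [c [d [[amax aex] key [dmin dc] [cmax cex]]]]] :=
  geodesic_top Hv n0 fb fe fe' yb zb ye xxe xxe' ze'.
- by rewrite -lE -tE -ltE; lra.
- by rewrite lt_neqAle eq_sym sy spread_ge0.
- by rewrite lt_neqAle eq_sym sz spread_ge0.
have [q [pq NMq]] : exists q, plus v pi rho M q /\ ~ M q.
  by have /nonsubset[q [h1 h2]] := NpM; exists q.
have aex' : exists2 u, u != 0 & hy u - (gauge M u)%:~R = a.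
  by have [u u0 uE] := aex; exists u => //; rewrite -hxE.
have cex' : exists2 u, u != 0 & hz u - (gauge M u)%:~R = c.
  by have [u u0 uE] := cex; exists u => //; rewrite -hxE.
(* The same q in M+ outside M is written as pi^-1 s + m and pi^-1 s' + m', with s top for hy - hx
   and s' top for hz - hx. *)
have [s [m [[Ms Mm] s0 hs qs]]] := plus_ball sM
  (fun c u => splits_scale ye) (fun u w => splits_ultra Hv ye)
  (fun g u => pnorm_stable Xy) aex' pq NMq.
have [s' [m' [[Ms' Mm'] s0' hs' qs']]] := plus_ball sM
  (fun c u => splits_scale zb) (fun u w => splits_ultra Hv zb)
  (fun g u => pnorm_stable Xz) cex' pq NMq.
(* Such a vector has gauge exactly 0: otherwise pi^-1 w, and with it q, would lie in M. *)
have hx0 w m1 : M w -> M m1 -> w != 0 -> q = pi ^ (-1) *: w + m1 -> hx w = 0.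
  move=> Mw Mm1 w0 qE; rewrite /hx hxE.
  have : 0 <= gauge M w by apply/(gauge_mem Hv Hpi).
  have : ~ 1 <= gauge M w.
    move=> /(gaugeP Hv Hpi _ lM w0) h; apply: NMq; rewrite qE.
    exact: submodD hM h Mm1.
  by move=> h1 h2; have -> : gauge M w = 0 by lia.
have hxs := hx0 _ _ Ms Mm s0 qs; have hxs' := hx0 _ _ Ms' Mm' s0' qs'.
have hys : hy s - hx s = a by have := amax _ s0; lra.
have hzs := key _ s0 hys.
have ssE : s - s' = pi ^ 1 *: (m' - m).
  have : pi ^ (-1) *: (s - s') = m' - m.
    rewrite scalerBr; apply/eqP; rewrite subr_eq addrAC eq_sym subr_eq -qs qs'.
    by rewrite addrC.
  by move=> <-; rewrite (piX_scaleK Hpi).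
have [ss|ss] := eqVneq (s - s') 0.
  have sE : s = s' by apply/eqP; rewrite -subr_eq0 ss.
  by move: hzs; rewrite sE; lra.
(* The 1 is the gain in hx from s - s' lying in pi M, on top of the lower bound d for hz - hx. *)
have hzd : d + 1 <= hz (s - s').
  have : 1 <= gauge M (s - s').
    apply/(gaugeP Hv Hpi) => //; rewrite ssE (piX_scaleNK Hpi).
    exact: (submodB Hv hM).
  rewrite -(ler_int R) -hxE -/hx; have := dmin _ ss; lra.
(* As s is top for hy - hx, hz(s) = d. But s is the sum of s - s' and s', with hz at least d + 1 and
   c, both larger than d. *)
have := splits_ultra Hv zb ss s0'; rewrite subrK => /(_ s0).
have hzs_d : hz s = d by rewrite -hzs hxs subr0.
rewrite hzs_d ge_min => /orP[h|h].
  by have := le_trans hzd h; rewrite gerDl ler10.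
by have := lt_le_trans dc (le_trans hs' h); rewrite ltxx.
Qed.

End Extremal.

Theorem theorem4p9
  (R : realType)
  (K : fieldType) (v : K -> int)
  (v_discrete : discrete_valuation v) (v_complete : val_complete v)
  (pi : K) (pi_uniformiser : uniformiser v pi)
  (F : fieldType) (red : K -> F) (red_residue : residue_map v red)
  (G : groupType) (V : vectType K) (rho : G -> 'End(V))
  (rho_rep : representation rho) (rho_irr : irreducible rho)
  (rho_lattice : exists L : set V, stable_lattice v rho L) :
  [/\ `I_(X_dim v pi rho).+1 #<= X_max v pi rho,
      forall (r : nat) (W : 'I_r -> vectType F)
             (sigma : forall i, G -> 'End(W i)) (m : 'I_r -> nat),
        residual_semisimplification v pi red rho sigma m ->
        (forall i, m i = 1%N) ->
        X_max v pi rho #= `I_(X_dim v pi rho).+1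
    & `I_(X_dim v pi rho).+1 #<= extremal_vertices R v pi rho].
Proof.
have card_ge := X_max_card_ge v_discrete v_complete pi_uniformiser rho_irr rho_lattice.
split=> //.
  move=> r W sigma m; exact: X_max_card_eq.
apply: card_le_trans card_ge _; apply: subset_card_le; exact: X_max_extremal.
Qed.
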